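(* Let $P=A_1\dots A_n$ and $Q=B_1\dots B_n$ be two simple parallel polygons in the plane. Then (a) $P$ and $Q$ have the same number of reflex vertices, and (b) if one of $P,Q$ is convex, then so is the other, and their corresponding internal angles are equal (the internal angle of $P$ at $A_i$ equals the internal angle of $Q$ at $B_i$ for all $1\leq i\leq n$).
   Context: A vertex of a simple polygon is reflex if the internal angle at that vertex is greater than $\pi$. Two simple polygons $P=A_1\dots A_n$ and $Q=B_1\dots B_n$ (vertices listed in cyclic order, indices modulo $n$) are called parallel polygons if they have the same orientation (both vertex sequences run clockwise or both run counterclockwise) and $A_iA_{i+1}\parallel B_iB_{i+1}$ for all $1\leq i\leq n$, where parallel means that the lines containing the sides have the same direction up to sign (the vectors $\overrightarrow{A_iA_{i+1}}$ and $\overrightarrow{B_iB_{i+1}}$ may be oppositely directed). *)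

(* Defs.v *)
(* The plane is R * R, for an arbitrary realType R. *)
From mathcomp Require Export all_boot all_order all_algebra.
From mathcomp Require Export all_classical all_reals all_analysis.

Set Implicit Arguments.
Unset Strict Implicit.
Unset Printing Implicit Defensive.

Export Order.TTheory GRing.Theory Num.Theory.
Export numFieldNormedType.Exports.

Local Open Scope classical_set_scope.
Local Open Scope ring_scope.

Section PlaneVectors.
Context {R : realType}.
Implicit Types u v : R * R.

Definition dot u v : R := u.1 * v.1 + u.2 * v.2.

Definition cross u v : R := u.1 * v.2 - u.2 * v.1.

(* The Euclidean norm; the library norm on R * R is the sup norm. *)
Definition enorm u : R := Num.sqrt (dot u u).

Definition rot90 u : R * R := (- u.2, u.1).

(* For nonzero u and v, the angle in [0, 2 pi[ through which u has to be
   rotated counterclockwise to get the direction of v. *)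
Definition ccw_angle u v : R :=
  let a := acos (dot u v / (enorm u * enorm v)) in
  if 0 <= cross u v then a else 2 * pi - a.

Definition parallel u v : Prop := exists2 c : R, c != 0 & v = c *: u.

Definition segment (a b : R * R) : set (R * R) :=
  [set a + t *: (b - a) | t in `[0, 1]].

End PlaneVectors.

Section Polygons.
Context {R : realType} {n : nat}.
Implicit Types P Q : 'I_n -> R * R.

(* ordS and ord_pred are the successor and the predecessor modulo n. *)
Definition edge P (i : 'I_n) : R * R := P (ordS i) - P i.

Definition side P (i : 'I_n) : set (R * R) := segment (P i) (P (ordS i)).

(* Two distinct sides may only meet at a common endpoint.  Internal angles
   equal to pi are allowed. *)
Definition simple_polygon P : Prop :=
  [/\ (2 < n)%N,
      injective P &
      forall i j : 'I_n, i != j ->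
        side P i `&` side P j `<=`
          [set P i; P (ordS i)] `&` [set P j; P (ordS j)]].

Definition boundary P : set (R * R) := \bigcup_(i in [set: 'I_n]) side P i.

(* The interior in the sense of the Jordan curve theorem: the union of the
   bounded connected components of the complement of the boundary.
   (connected_component A x is empty, hence bounded, when x is not in A.) *)
Definition inside P : set (R * R) :=
  [set x | ~ boundary P x /\
           bounded_set (connected_component (~` boundary P) x)].

(* The interior lies immediately to the left, respectively to the right, of
   every side. *)
Definition counterclockwise P : Prop :=
  forall (i : 'I_n) (t : R), 0 < t < 1 ->
    \forall e \near (0 : R)^'+,
      inside P (P i + t *: edge P i + e *: rot90 (edge P i)).

Definition clockwise P : Prop :=
  forall (i : 'I_n) (t : R), 0 < t < 1 ->
    \forall e \near (0 : R)^'+,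
      inside P (P i + t *: edge P i - e *: rot90 (edge P i)).

Definition same_orientation P Q : Prop :=
  (counterclockwise P /\ counterclockwise Q) \/ (clockwise P /\ clockwise Q).

Definition parallel_polygons P Q : Prop :=
  same_orientation P Q /\ forall i : 'I_n, parallel (edge P i) (edge Q i).

(* The two sides at P i cut a small disc around P i into two sectors.
   [sector_angle] is the measure of the one swept counterclockwise from
   P (ordS i) - P i to P (ord_pred i) - P i, and [sector_inside] says that this
   sector lies in the interior near P i. *)
Definition sector_angle P (i : 'I_n) : R :=
  ccw_angle (P (ordS i) - P i) (P (ord_pred i) - P i).

Definition sector_inside P (i : 'I_n) : Prop :=
  forall u : R * R, u != 0 ->
    0 < ccw_angle (P (ordS i) - P i) u < sector_angle P i ->
    \forall e \near (0 : R)^'+, inside P (P i + e *: u).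

(* Exactly one of the two sectors is interior when P is simple. *)
Definition internal_angle P (i : 'I_n) : R :=
  if `[< sector_inside P i >] then sector_angle P i
  else 2 * pi - sector_angle P i.

Definition reflex P (i : 'I_n) : bool := pi < internal_angle P i.

(* The closed region bounded by P is convex. *)
Definition convex_polygon P : Prop := convex_set (boundary P `|` inside P).

End Polygons.

(* Main.v *)
Require Import Defs.
From mathcomp Require Import ring lra zify.

(** Counting how often the direction of a side crosses a line replaces all
angle sums.  Fix a nonzero vector [w] and call a vector up or down according
to the side of the line [R w] on which it points, a vector of that line being
up when it has the direction of [w].  When the direction turns at a vertex of
[P] from one side to the next, it crosses the line exactly when one of the two
sides is up and the other down, and the sense of the crossing is the sign of
the turn, that is, of the cross product of the two sides.

The turning number of a simple polygon is 1 in absolute value, so these signed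
crossings add up to 2 or to -2 ([crossing_sum]).  This is Hopf's argument in a
discrete form: two disjoint sides differ by a parallelogram of vectors that
misses the origin, hence lies in an open half plane, where crossings are
additive; so the sum along the sides of [P] can be deformed to the sum along
the vectors issuing from the lowest vertex, which are all up.  The sum is twice
the sign of the turn at that vertex, and this sign is the orientation, because
the points below the lowest vertex are outside ([lowest_turn],
[total_turning]).

For (a), the crossing at a vertex is half of the sign of the turn times
[1 - s s'], where [s] and [s'] are the signs (1 for up, -1 for down) of the two
sides.  Reversing a side changes the sign of the turn and the product [s s']
simultaneously, so the product of the sign of the turn by [s s'] is the same
for [P] and [Q].  Hence the signs of the turns have the same sum for [P] and
[Q] ([sum_turns]); as they vanish at the same vertices, there are as many
turns in the wrong sense, that is, reflex vertices, in [P] as in [Q]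
([reflex_count]).

For (b), a polygon is convex if and only if it has no reflex vertex, which (a)
transfers from one polygon to the other; and an internal angle that is at most
[pi] is determined by the directions of its sides up to sign.  A short segment
across a reflex vertex leaves the polygon ([convex_no_reflex]).  Conversely, if
all turns have the same sense, the value 2 of the total count leaves no room
for more than one rise and one fall with respect to any side, so [P] lies on
one side of each of its sides ([all_on_one_side]) and the closed region is an
intersection of half planes ([region_half_planes]).

What links these combinatorial facts with the topological interior is a local
study of the boundary.  Near a vertex it consists of two rays that cut out two
sectors; being inside, or not being inside, is constant on each sector
([meets_fills]) and is transmitted along each side from the sectors at one end
to those at the other ([meets_ordS]).  So the interior fills one sector at each
vertex ([inside_fills]) and the exterior, which fills the other one at the
lowest vertex, fills the other one everywhere ([outside_fills]). *)

Set Implicit Arguments.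
Unset Strict Implicit.
Unset Printing Implicit Defensive.
Local Open Scope classical_set_scope.
Local Open Scope ring_scope.

(** * Separation of a parallelogram from the origin *)

Section Vectors.
Context {R : realType}.
Implicit Types (a b e f u v w x y z : R * R) (k l m s t : R).

Lemma fst_add u v : (u + v).1 = u.1 + v.1. Proof. by []. Qed.
Lemma snd_add u v : (u + v).2 = u.2 + v.2. Proof. by []. Qed.
Lemma fst_opp u : (- u).1 = - u.1. Proof. by []. Qed.
Lemma snd_opp u : (- u).2 = - u.2. Proof. by []. Qed.
Lemma fst_scale k u : (k *: u).1 = k * u.1. Proof. by []. Qed.
Lemma snd_scale k u : (k *: u).2 = k * u.2. Proof. by []. Qed.

Definition coordE :=
  (fst_add, snd_add, fst_opp, snd_opp, fst_scale, snd_scale).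

Lemma vec_eq u v : u.1 = v.1 -> u.2 = v.2 -> u = v.
Proof. by case: u v => ? ? [? ?] /= -> ->. Qed.

Lemma dot_gt0 u : u != 0 -> 0 < dot u u.
Proof.
move=> u0; rewrite /dot -!expr2.
rewrite lt_neqAle addr_ge0 ?sqr_ge0// andbT eq_sym paddr_eq0 ?sqr_ge0//.
rewrite !sqrf_eq0; apply: contra u0 => /andP[/eqP u1 /eqP u2].
by apply/eqP; exact: vec_eq.
Qed.

Lemma collinear_scale u v : u != 0 -> cross u v = 0 ->
  v = (dot u v / dot u u) *: u.
Proof.
move=> /dot_gt0 u0 uv0.
have d0 : dot u u != 0 by rewrite gt_eqF.
apply: vec_eq; rewrite coordE; apply: (mulfI d0).
  transitivity (dot u v * u.1 - u.2 * cross u v); last first.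
    by rewrite uv0; field.
  by rewrite /dot /cross; ring.
transitivity (dot u v * u.2 + u.1 * cross u v); last first.
  by rewrite uv0; field.
by rewrite /dot /cross; ring.
Qed.

Lemma conv01 l s t : 0 <= l <= 1 -> 0 <= s <= 1 -> 0 <= t <= 1 ->
  0 <= (1 - l) * s + l * t <= 1.
Proof. by move=> /andP[? ?] /andP[? ?] /andP[? ?]; apply/andP; split; nra. Qed.

(** The point of the parallelogram closest to the origin is a normal vector of a
separating line: moving from it towards another point of the parallelogram
cannot decrease the norm to first order. *)
Lemma parallelogram_separation a e f :
  (forall s t, 0 <= s <= 1 -> 0 <= t <= 1 -> a + s *: e + t *: f != 0) ->
  exists z m, 0 < m /\
    forall s t, 0 <= s <= 1 -> 0 <= t <= 1 -> m <= dot z (a + s *: e + t *: f).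
Proof.
move=> nz; pose q x := a + x.1 *: e + x.2 *: f.
pose g x := dot (q x) (q x).
have gc : continuous g.
  move=> x; rewrite /g /dot /q /=.
  have c1 : (fun y : R * R => y.1) @ x --> x.1 by exact: cvg_fst.
  have c2 : (fun y : R * R => y.2) @ x --> x.2 by exact: cvg_snd.
  apply: cvgD; apply: cvgM; (apply: cvgD; [apply: cvgD; [exact: cvg_cst|]|]);
    apply: cvgM => //; exact: cvg_cst.
pose A : set (R * R) := `[0, 1]%classic `*` `[0, 1]%classic.
have [|||c] := @compact_EVT_min _ R g A.
- by exists (0, 0); split; rewrite /= in_itv /= lexx ler01.
- by apply: compact_setX; exact: segment_compact.
- exact: continuous_subspaceT.
rewrite inE => -[c1 c2] cmin.
rewrite /= in_itv /= in c1 c2.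
exists (q c), (g c); split; first exact/dot_gt0/nz.
move=> s t s01 t01; rewrite -/(q (s, t)).
rewrite leNgt; apply/negP => lt.
pose d := q (s, t) - q c; pose D := dot (q c) d.
have D0 : D < 0.
  have -> : D = dot (q c) (q (s, t)) - g c.
    by rewrite /D /d /g /dot !coordE; ring.
  by rewrite subr_lt0.
have d0 : 0 < dot d d.
  apply: dot_gt0; apply/eqP => d0; move: D0.
  by rewrite /D d0 /dot /= !mulr0 addr0 ltxx.
(* a fraction of the way for which the first order term still dominates *)
pose l := Num.min 1 (- D / dot d d).
have l0 : 0 < l by rewrite lt_min ltr01 divr_gt0// oppr_gt0.
have l1 : l <= 1 by rewrite ge_min lexx.
have ld : l * dot d d <= - D by rewrite -ler_pdivlMr// ge_min lexx orbT.
pose c' := ((1 - l) * c.1 + l * s, (1 - l) * c.2 + l * t).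
have : g c <= g c'.
  apply: cmin; rewrite inE; split; rewrite /= in_itv /=.
    by apply: conv01 => //; rewrite l1 ltW.
  by apply: conv01 => //; rewrite l1 ltW.
have -> : g c' = g c + l * (2 * D + l * dot d d).
  by rewrite /g /D /d /dot /q !coordE /=; ring.
by apply/negP; rewrite -ltNge gtrDl pmulr_rlt0//; lra.
Qed.

End Vectors.

(** * Signed crossings of a line *)

Section Crossings.
Context {R : realType}.
Implicit Types (u v w z : R * R).

(** Lexicographic, so that exactly one of two opposite nonzero vectors is up. *)
Definition up w u : bool :=
  (0 < cross w u) || ((cross w u == 0) && (0 < dot w u)).

Definition crossing w u v : int :=
  if up w u == up w v then 0 else sgz (cross u v).

Lemma crossNr u v : cross u (- v) = - cross u v.
Proof. by rewrite /cross !coordE; ring. Qed.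

Lemma crossNl u v : cross (- u) v = - cross u v.
Proof. by rewrite /cross !coordE; ring. Qed.

Lemma dotNr u v : dot u (- v) = - dot u v.
Proof. by rewrite /dot !coordE; ring. Qed.

Lemma dotDr u v w : dot u (v + w) = dot u v + dot u w.
Proof. by rewrite /dot !coordE; ring. Qed.

Lemma crossDr u v w : cross u (v + w) = cross u v + cross u w.
Proof. by rewrite /cross !coordE; ring. Qed.

Lemma crossC u v : cross u v = - cross v u.
Proof. by rewrite /cross; ring. Qed.

Lemma cross_dot_eq0 u v : u != 0 -> cross u v = 0 -> dot u v = 0 -> v = 0.
Proof.
by move=> u0 c0 d0; rewrite (collinear_scale u0 c0) d0 mul0r scale0r.
Qed.

Lemma upN w u : w != 0 -> u != 0 -> up w (- u) = ~~ up w u.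
Proof.
move=> w0 u0; rewrite /up crossNr dotNr oppr_gt0 oppr_eq0 oppr_gt0.
case: (ltgtP (cross w u) 0) => //= c0.
case: (ltgtP (dot w u) 0) => // d0.
by move: u0; rewrite (cross_dot_eq0 w0 c0 d0) eqxx.
Qed.

Lemma up_neq0 w u : up w u -> u != 0.
Proof.
apply: contraTneq => ->.
by rewrite /up /cross /dot /= !mulr0 subr0 addr0 ltxx andbF.
Qed.

Lemma upD w u v : up w u -> up w v -> up w (u + v).
Proof.
rewrite /up crossDr dotDr.
case: (ltgtP (cross w u) 0) => //= cu; case: (ltgtP (cross w v) 0) => //= cv.
- by rewrite addr_gt0.
- by rewrite cv addr0 cu.
- by rewrite cu add0r cv.
by rewrite cu cv addr0 eqxx ltxx /= => *; rewrite addr_gt0.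
Qed.

Lemma crossingNN w u v : w != 0 -> u != 0 -> v != 0 ->
  crossing w (- u) (- v) = crossing w u v.
Proof.
move=> w0 u0 v0; rewrite /crossing !upN// (inj_eq negb_inj).
by rewrite crossNl crossNr opprK.
Qed.

Lemma sgz_mul_gt0 (x y : R) : 0 < x * y -> sgz x = sgz y.
Proof.
case: (ltgtP x 0) => [x0|x0|->]; last by rewrite mul0r ltxx.
  by rewrite nmulr_rgt0// => y0; rewrite !ltr0_sgz.
by rewrite pmulr_rgt0// => y0; rewrite !gtr0_sgz.
Qed.

(** Inside an open half plane only one of the two rays of the line [R w] is
visible, so a rotation crosses it in a direction fixed by the half plane. *)
Lemma crossing_half_plane w z u v : w != 0 -> 0 < dot z u -> 0 < dot z v ->
  crossing w u v = sgz (dot w z) * ((up w v)%:Z - (up w u)%:Z).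
Proof.
move=> w0.
suff main u' v' : 0 < dot z u' -> 0 < dot z v' -> ~~ up w u' -> up w v' ->
    sgz (cross u' v') = sgz (dot w z).
  move=> zu zv; rewrite /crossing.
  case: (boolP (up w u)) (boolP (up w v)) => [wu|wu] [wv|wv] /=;
    rewrite ?subrr ?mulr0//.
    by rewrite crossC sgzN (main v u)// sub0r mulrN1.
  by rewrite (main u v)// subr0 mulr1.
move=> {u v} zu zv; rewrite /up negb_or negb_and -!leNgt => /andP[cu du] v_up.
apply/esym/sgz_mul_gt0.
have -> : dot w z * cross u' v' = cross w v' * dot z u' - cross w u' * dot z v'.
  by rewrite /dot /cross; ring.
have cv : 0 <= cross w v' by case/orP: v_up => [/ltW//|/andP[/eqP-> _]].
case: (ltgtP (cross w u') 0) cu => // [cu _|cu _].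
  by rewrite ltr_wpDl ?mulr_ge0 ?(ltW zu)// oppr_gt0 pmulr_llt0.
case: (ltgtP (cross w v') 0) cv => // [cv _|cv _].
  by rewrite cu mul0r subr0 mulr_gt0.
move: du v_up; rewrite cu cv eqxx ltxx /= => du dv.
move: zu zv; rewrite (collinear_scale w0 cu) (collinear_scale w0 cv).
have scal k : dot z (k *: w) = k * dot z w by rewrite /dot !coordE; ring.
rewrite !scal => zu zv; exfalso.
have dw := dot_gt0 w0.
have ku : dot w u' / dot w w <= 0 by rewrite pmulr_lle0 ?invr_gt0.
have kv : 0 < dot w v' / dot w w by rewrite divr_gt0.
by move: zv; rewrite pmulr_rgt0// => /ltW zw; nra.
Qed.

Lemma crossing_add w z u v t : w != 0 ->
  0 < dot z u -> 0 < dot z v -> 0 < dot z t ->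
  crossing w u v + crossing w v t = crossing w u t.
Proof.
move=> w0 zu zv zt; rewrite !(crossing_half_plane (z := z))//.
by rewrite -mulrDr addrC addrA subrK.
Qed.

Lemma common_half_plane u v : u != 0 -> (cross u v = 0 -> 0 < dot u v) ->
  exists z, 0 < dot z u /\ 0 < dot z v.
Proof.
move=> u0 uv; have [c0|c0] := eqVneq (cross u v) 0.
  by exists u; split; [exact: dot_gt0|exact: uv].
(* the vector whose scalar products with u and v are both 1 *)
exists ((v.2 - u.2) / cross u v, (u.1 - v.1) / cross u v).
have c0' := c0; rewrite /cross in c0.
by split; rewrite (_ : dot _ _ = 1) ?ltr01// /dot /cross /=; field.
Qed.

Lemma crossing_triangle w u v : w != 0 -> u != 0 ->
  (cross u v = 0 -> 0 < dot u v) ->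
  crossing w u (u + v) + crossing w (u + v) v = crossing w u v.
Proof.
move=> w0 u0 /(common_half_plane u0)[z [zu zv]].
by apply: (crossing_add (z := z)) => //; rewrite dotDr addr_gt0.
Qed.

Section Chain.
Variables (w : R * R) (p : nat -> R * R) (m : nat).
Let e i := p i.+1 - p i.
Hypothesis w0 : w != 0.
Hypothesis closed_p : p m.+3 = p 0%N.
Hypothesis e0 : forall i, (i < m.+3)%N -> e i != 0.
Hypothesis turn : forall i, (i < m.+2)%N ->
  cross (e i) (e i.+1) = 0 -> 0 < dot (e i) (e i.+1).
Hypothesis turn_last :
  cross (e m.+2) (e 0%N) = 0 -> 0 < dot (e m.+2) (e 0%N).
Hypothesis disjoint_sides : forall i j,
  (i.+1 < j)%N -> (j < m.+3)%N -> (0 < i)%N || (j < m.+2)%N ->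
  forall s t, 0 <= s <= 1 -> 0 <= t <= 1 -> p i + s *: e i != p j + t *: e j.
Hypothesis lowest : forall j, (0 < j)%N -> (j < m.+3)%N -> up w (p j - p 0%N).

Let H i j := crossing w (p j - p i) (p j.+1 - p i).
Let V i j := crossing w (p j - p i) (p j - p i.+1).

(** The differences of a point of side [i] and a point of side [j] fill a
parallelogram that misses the origin, hence lies in an open half plane. *)
Lemma crossing_cell i j :
  (i.+1 < j)%N -> (j < m.+3)%N -> (0 < i)%N || (j < m.+2)%N ->
  V i j + H i.+1 j = H i j + V i j.+1.
Proof.
move=> ij jm cor.
have [|z [mu [mu0 sep]]] := @parallelogram_separation _ (p j - p i) (- e i) (e j).
  move=> s t s01 t01.
  have := disjoint_sides ij jm cor s01 t01; rewrite -subr_eq0 -oppr_eq0.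
  by apply: contraNN => /eqP <-; rewrite scalerN; apply/eqP/vec_eq; rewrite !coordE; ring.
have [I0 I1] : 0 <= (0 : R) <= 1 /\ 0 <= (1 : R) <= 1 by rewrite lexx ler01 lexx.
have z1 := lt_le_trans mu0 (sep _ _ I0 I0).
have z2 := lt_le_trans mu0 (sep _ _ I0 I1).
have z3 := lt_le_trans mu0 (sep _ _ I1 I0).
have z4 := lt_le_trans mu0 (sep _ _ I1 I1).
have E1 : p j - p i + (0 : R) *: - e i + (0 : R) *: e j = p j - p i.
  by apply/vec_eq; rewrite !coordE; ring.
have E2 : p j - p i + (0 : R) *: - e i + (1 : R) *: e j = p j.+1 - p i.
  by apply/vec_eq; rewrite !coordE; ring.
have E3 : p j - p i + (1 : R) *: - e i + (0 : R) *: e j = p j - p i.+1.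
  by apply/vec_eq; rewrite !coordE; ring.
have E4 : p j - p i + (1 : R) *: - e i + (1 : R) *: e j = p j.+1 - p i.+1.
  by apply/vec_eq; rewrite !coordE; ring.
rewrite E1 in z1; rewrite E2 in z2; rewrite E3 in z3; rewrite E4 in z4.
by rewrite /V /H !(crossing_add (z := z)).
Qed.

(** The path from [(a, j)] to [(i, j.+1)] in the grid of pairs of vertices may go
round a column of cells on either side. *)
Lemma crossing_column a i j : (a <= i)%N -> (i < j)%N -> (j < m.+3)%N ->
  (0 < a)%N || (j < m.+2)%N ->
  \sum_(a <= k < i) V k j + H i j = H a j + \sum_(a <= k < i) V k j.+1.
Proof.
move=> ai ij jm cor; elim: i ai ij => [|i IH] ai ij.
  by move: ai; rewrite leqn0 => /eqP->; rewrite !big_geq// add0r addr0.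
move: ai; rewrite leq_eqVlt => /orP[/eqP->|].
  by rewrite !big_geq// add0r addr0.
rewrite ltnS => ai; rewrite !big_nat_recr//= -addrA crossing_cell//; last first.
  by case/orP: cor => [a0|->]; rewrite ?orbT// (leq_trans a0 ai).
by rewrite addrA IH ?addrA// ltnW.
Qed.

Lemma crossing_diagonal i : (i < m.+2)%N ->
  crossing w (e i) (e i.+1) = H i i.+1 + V i i.+2.
Proof.
move=> im; rewrite -(crossing_triangle w0 (e0 _) (turn im)) 1?ltnW//.
have -> // : e i + e i.+1 = p i.+2 - p i.
by rewrite /e addrC addrA subrK.
Qed.

(** The path that follows the diagonal can be pushed to the leg [i = 0], on which
no crossing occurs, followed by a column. *)
Lemma crossing_staircase k : (k <= m.+1)%N ->
  \sum_(0 <= i < k) crossing w (e i) (e i.+1) = \sum_(0 <= i < k) V i k.+1.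
Proof.
elim: k => [|k IH] km; first by rewrite !big_geq.
rewrite !big_nat_recr//= IH 1?ltnW// crossing_diagonal; last exact: ltnW.
rewrite addrA (@crossing_column 0)//; last exact: leqW.
by rewrite /H /crossing !lowest ?eqxx ?add0r// !ltnS ltnW.
Qed.

(** Hopf's argument: on the triangle of pairs [i < j] the direction of
[p j - p i] has a continuous angle, so the path along the diagonal, which
follows the sides, can be replaced by the path along the two legs.  As the
polygon lies on one side of the line through [p 0] directed by [w], the legs
contribute nothing, except near the corner where [p j = p i]. *)
Lemma crossing_sum_chain :
  \sum_(0 <= i < m.+2) crossing w (e i) (e i.+1) + crossing w (e m.+2) (e 0%N)
  = 2 * sgz (cross (e m.+2) (e 0%N)).
Proof.
have em : p m.+2 - p 0%N = - e m.+2 by rewrite /e closed_p opprB.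
have up0 : up w (e 0%N) by rewrite lowest.
have upm : up w (e m.+2) = false.
  have := upN w0 (e0 (leqnn m.+3)); rewrite -em lowest//.
  by move/esym/negbTE.
rewrite big_nat_recr//= crossing_staircase// big_ltn// crossing_diagonal//.
rewrite addrA -[_ + _ + H _ _]addrA (@crossing_column 1)//.
have V0 i : (0 < i)%N -> (i.+1 < m.+3)%N -> V i m.+3 = 0.
  move=> i0 im; rewrite /V /crossing closed_p -(opprB (p i)) -(opprB (p i.+1)).
  have im' := ltnW im.
  by rewrite !upN ?lowest ?eqxx ?(up_neq0 (lowest _ _)).
rewrite V0// addr0 big_nat big1 ?addr0; last first.
  by move=> i /andP[i0 im]; rewrite V0// ltnS ltnW.
have -> : V 0%N m.+2 + H 1%N m.+2 = crossing w (e m.+2) (e 0%N).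
  rewrite -crossingNN ?e0// -crossing_triangle ?oppr_eq0 ?e0//.
    have -> : - e 0%N = p 0%N - p 1%N by rewrite /e opprB.
    rewrite /V /H closed_p -em.
    suff -> : p m.+2 - p 1 = p m.+2 - p 0%N + (p 0%N - p 1) by [].
    by rewrite addrA subrK.
  by rewrite crossNl crossNr opprK => /turn_last; rewrite /dot !coordE !mulrNN.
by rewrite -mulr2n /crossing up0 upm /= mulr_natl.
Qed.

End Chain.
End Crossings.

(** * Simple polygons *)

Lemma val_iter_ordS n (m : 'I_n) k : iter k (@ordS n) m = ((m + k) %% n)%N :> nat.
Proof.
elim: k => [|k IH] /=; first by rewrite addn0 modn_small.
by rewrite IH -addn1 modnDml addn1 addnS.
Qed.

Lemma iter_ordS_inj n (m : 'I_n) j k : (j < n)%N -> (k < n)%N ->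
  iter j (@ordS n) m = iter k (@ordS n) m -> j = k.
Proof.
move=> jn kn /(congr1 val) /=; rewrite !val_iter_ordS => /eqP.
by rewrite eqn_modDl !modn_small// => /eqP.
Qed.

Lemma iter_ordS_n n (m : 'I_n) q : q = n -> iter q (@ordS n) m = m.
Proof. by move=> ->; apply/val_inj; rewrite /= val_iter_ordS modnDr modn_small. Qed.

Lemma sum_iter_ordS n (m : 'I_n) (F : 'I_n -> int) q : q = n ->
  \sum_(0 <= k < q) F (iter k (@ordS n) m) = \sum_i F i.
Proof.
move=> ->; rewrite big_mkord [RHS](reindex (fun k : 'I_n => iter k (@ordS n) m))//.
by apply/onW_bij/injF_bij => j k /iter_ordS_inj jk; exact/val_inj/jk.
Qed.

Section SimplePolygon.
Context {R : realType} {n : nat} (P : 'I_n -> R * R).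
Hypothesis hP : simple_polygon P.
Implicit Types (i j m : 'I_n) (w : R * R).

Let n2 : (2 < n)%N. Proof. by case: hP. Qed.
Let Pinj : injective P. Proof. by case: hP. Qed.

Lemma ordS_neq i : ordS i != i.
Proof.
apply/eqP => h; have := @iter_ordS_inj _ i 1 0 _ _ h.
by move=> /(_ (ltnW n2) (ltnW (ltnW n2))).
Qed.

Lemma ordSS_neq i : ordS (ordS i) != i.
Proof.
apply/eqP => h; have := @iter_ordS_inj _ i 2 0 _ _ h.
by move=> /(_ n2 (ltnW (ltnW n2))).
Qed.

Lemma edge_neq0 i : edge P i != 0.
Proof. by rewrite /edge subr_eq0 (inj_eq Pinj) ordS_neq. Qed.

Lemma side_mem i (t : R) : 0 <= t <= 1 -> side P i (P i + t *: edge P i).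
Proof. by move=> t01; exists t. Qed.

Lemma sideP i x : side P i x ->
  exists2 t : R, 0 <= t <= 1 & x = P i + t *: edge P i.
Proof. by case=> t; rewrite /= in_itv /= => t01 <-; exists t. Qed.

Lemma sides_disjoint i j (s t : R) : i != j -> ordS i != j -> ordS j != i ->
  0 <= s <= 1 -> 0 <= t <= 1 -> P i + s *: edge P i != P j + t *: edge P j.
Proof.
move=> ij Sij Sji s01 t01; apply/eqP => h.
have [_ _ /(_ i j ij)] := hP => /(_ (P i + s *: edge P i)).
have sj : side P j (P i + s *: edge P i) by rewrite h; exact: side_mem.
case=> [|[] ->]; first by split=> //; exact: side_mem.
  by case=> /Pinj e; [rewrite e eqxx in ij|rewrite e eqxx in Sji].
by case=> /Pinj e; [rewrite e eqxx in Sij|rewrite (ordS_inj e) eqxx in ij].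
Qed.

Lemma vertex_notin_side i j : j != i -> ordS j != i -> ~ side P j (P i).
Proof.
move=> ji Sji Pij.
have [_ _ /(_ i j)] := hP; rewrite eq_sym => /(_ ji (P i)).
case=> [|_ []/Pinj e].
- by split=> //; have := @side_mem i 0; rewrite scale0r addr0; apply; rewrite lexx ler01.
- by rewrite e eqxx in ji.
- by rewrite e eqxx in Sji.
Qed.

(** Two consecutive sides pointing in opposite directions would overlap. *)
Lemma no_half_turn i : cross (edge P i) (edge P (ordS i)) = 0 ->
  0 < dot (edge P i) (edge P (ordS i)).
Proof.
set e := edge P i => c0; rewrite ltNge; apply/negP => d0.
have e0 : e != 0 := edge_neq0 i.
have := collinear_scale e0 c0; set k := _ / _ => ek.
have k0 : k < 0.
  rewrite lt_neqAle; apply/andP; split.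
    by apply: contra_neq (edge_neq0 (ordS i)) => k0; rewrite ek k0 scale0r.
  by rewrite pmulr_lle0 ?invr_gt0 ?dot_gt0.
have PS : P (ordS i) = P i + e by rewrite addrC subrK.
have [k1|k1] := lerP (-1) k.
  apply: (@vertex_notin_side (ordS (ordS i)) i).
  - by rewrite eq_sym ordSS_neq.
  - by rewrite eq_sym ordS_neq.
  have -> : P (ordS (ordS i)) = P i + (1 + k) *: e.
    rewrite -(subrK (P (ordS i)) (P (ordS (ordS i)))) -/(edge P (ordS i)) ek PS.
    by apply: vec_eq; rewrite !coordE; ring.
  by apply: side_mem; lra.
apply: (@vertex_notin_side i (ordS i)).
- exact: ordS_neq.
- exact: ordSS_neq.
have kN : k != 0 by rewrite lt_eqF.
have -> : P i = P (ordS i) + (- k^-1) *: edge P (ordS i).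
  by rewrite ek PS; apply: vec_eq; rewrite !coordE; field.
apply: side_mem; rewrite oppr_ge0 invr_le0 ltW//= -invrN invf_le1; lra.
Qed.

Lemma lowest_vertex w : w != 0 ->
  exists m, forall j, j != m -> up w (P j - P m).
Proof.
move=> w0; have i0 : 'I_n := Ordinal (ltnW (ltnW n2)).
case: (@Order.TotalTheory.arg_minP _ _ _ i0 xpredT (fun i => cross w (P i))) => // m1 _ m1min.
pose cond := [pred i | cross w (P i) == cross w (P m1)].
case: (@Order.TotalTheory.arg_minP _ _ _ m1 cond (fun i => dot w (P i))) => [|m /eqP cm mmin].
  by rewrite /= eqxx.
exists m => j jm; rewrite /up crossDr dotDr crossNr dotNr subr_gt0 subr_eq0 subr_gt0 cm.
have := m1min j isT; rewrite le_eqVlt => /orP[/eqP cj|->//].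
rewrite -cj eqxx ltxx /= lt_neqAle mmin ?andbT; last by rewrite /= cj.
apply: contraNneq jm => dj; apply/eqP/Pinj/eqP; rewrite -subr_eq0.
apply/eqP/(cross_dot_eq0 w0); first by rewrite crossDr crossNr cm -cj subrr.
by rewrite dotDr dotNr dj subrr.
Qed.

(** The total turning of a simple polygon, counted by the crossings of an
arbitrary line: at the lowest vertex the polygon turns like the whole. *)
Lemma crossing_sum w m : w != 0 -> (forall j, j != m -> up w (P j - P m)) ->
  \sum_i crossing w (edge P (ord_pred i)) (edge P i)
  = 2 * sgz (cross (edge P (ord_pred m)) (edge P m)).
Proof.
move=> w0 low.
rewrite (reindex_inj (@ordS_inj n)) /=.
pose p k := P (iter k (@ordS n) m).
have [q nq] : exists q, n = q.+3 by move: n2; case: (n) => [|[|[|q]]]// _; exists q.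
have closed_p : p q.+3 = p 0%N by rewrite /p iter_ordS_n.
have last_pred : iter q.+2 (@ordS n) m = ord_pred m.
  by apply: (@ordS_inj n); rewrite ord_predK -iterS iter_ordS_n.
rewrite /= in last_pred.
have := @crossing_sum_chain _ w p q w0 closed_p.
rewrite /edge /p /= last_pred ord_predK => <- //.
- rewrite -(sum_iter_ordS m _ (esym nq)) big_nat_recr//= last_pred ordSK ord_predK; congr (_ + _).
  by apply: eq_bigr => k _; rewrite ordSK.
- by move=> i _; exact: edge_neq0.
- by move=> i _; exact: no_half_turn.
- have := @no_half_turn (ord_pred m); rewrite /edge ord_predK; exact.
- move=> i j ij jq cor s t s01 t01; apply: sides_disjoint => //.
  + apply/eqP => /iter_ordS_inj h; lia.
  + apply/eqP => /(@iter_ordS_inj _ m i.+1 j) h; lia.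
  + apply/eqP; have [jq2 h|jq2] := ltnP j q.+2.
      have := @iter_ordS_inj _ m j.+1 i _ _ h; lia.
    have -> : ordS (iter j (@ordS n) m) = iter 0 (@ordS n) m.
      have -> : j = q.+2 by lia.
      by rewrite /= last_pred ord_predK.
    by move/iter_ordS_inj => h; lia.
- move=> j j0 jq; apply: low; apply/eqP => /(@iter_ordS_inj _ m j 0) h.
  lia.
Qed.

End SimplePolygon.

(** * Segments and components off the boundary *)

Section SmallRadii.
Context {R : realType}.
Implicit Types (a c u v x y z : R * R) (r s t : R).

Lemma near0_rightP (Q : R -> Prop) : (\forall e \near 0^'+, Q e) <->
  exists2 d, 0 < d & forall e, 0 < e < d -> Q e.
Proof.
split=> [[d /= d0 dQ]|[d d0 dQ]]; last first.
  near=> e; apply: dQ; apply/andP; split; near: e.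
    exact: nbhs_right_gt.
  exact: nbhs_right_lt.
exists d => // e /andP[e0 ed]; apply: dQ => //=.
by rewrite sub0r normrN gtr0_norm.
Unshelve. all: by end_near. Qed.

Lemma finite_radius (I : finType) (Q : I -> R * R -> Prop) :
  (forall i, exists2 r, 0 < r & forall v, `|v| < r -> Q i v) ->
  exists2 r, 0 < r & forall i v, `|v| < r -> Q i v.
Proof.
move=> h; have /choice[r hr] : forall i, exists r, 0 < r /\ forall v, `|v| < r -> Q i v.
  by move=> i; have [r] := h i; exists r.
exists (\big[Num.min/1]_i r i).
  by apply: lt_bigmin => // i _; have [] := hr i.
move=> i v vr; have [_] := hr i; apply.
exact: lt_le_trans vr (bigmin_le_cond _ _ isT).
Qed.

Lemma dot_le_norm z v : dot z v <= (`|z.1| + `|z.2|) * `|v|.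
Proof.
have v1 : `|v.1| <= `|v| by rewrite prod_normE le_max lexx.
have v2 : `|v.2| <= `|v| by rewrite prod_normE le_max lexx orbT.
rewrite /dot mulrDl; apply: lerD; (apply: (le_trans (ler_norm _));
  by rewrite normrM ler_wpM2l).
Qed.

(** Disjoint segments are at a positive distance, seen in the direction of the
vector [z] provided by the separation of their difference from the origin. *)
Lemma disjoint_segments_radius a c (e f : R * R) :
  (forall s t, 0 <= s <= 1 -> 0 <= t <= 1 -> a + s *: e != c + t *: f) ->
  exists2 r, 0 < r & forall v, `|v| < r ->
    forall s t, 0 <= s <= 1 -> 0 <= t <= 1 -> a + s *: e + v != c + t *: f.
Proof.
move=> dis; have [|z [mu [mu0 sep]]] := @parallelogram_separation _ (c - a) (- e) f.
  move=> s t s01 t01; have := dis s t s01 t01; rewrite -subr_eq0 -oppr_eq0.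
  by apply: contraNN => /eqP <-; apply/eqP/vec_eq; rewrite !coordE; ring.
pose K := `|z.1| + `|z.2| + 1.
have K0 : 0 < K by rewrite ltr_wpDl// addr_ge0.
exists (mu / K); first by rewrite divr_gt0.
move=> v vr s t s01 t01; apply/eqP => h.
have := sep s t s01 t01.
have -> : c - a + s *: - e + t *: f = v.
  apply: vec_eq.
    by have := congr1 fst h; rewrite !coordE => h1; lra.
  by have := congr1 snd h; rewrite !coordE => h1; lra.
apply/negP; rewrite -ltNge; apply: le_lt_trans (dot_le_norm _ _) _.
rewrite ltr_pdivlMr// in vr; apply: le_lt_trans vr.
by rewrite mulrC ler_wpM2l// lerDl.
Qed.

Lemma connected_interval_image (f : R -> R * R) (A : set R) :
  is_interval A -> continuous f -> connected (f @` A).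
Proof.
move=> iA fc; apply: connected_continuous_connected.
  exact/connected_intervalP.
exact: continuous_subspaceT.
Qed.

Lemma affine_continuous x u : continuous (fun t : R => x + t *: u).
Proof. by move=> t; apply: cvgD; [exact: cvg_cst|exact: scalel_continuous]. Qed.

End SmallRadii.

Section Components.
Context {R : realType} {n : nat} (P : 'I_n -> R * R).
Implicit Types (x y u : R * R) (A : set (R * R)).

Definition clear x y := forall t : R, 0 <= t <= 1 -> ~ boundary P (x + t *: (y - x)).

Lemma clear_sym x y : clear x y -> clear y x.
Proof.
move=> c t t01; have -> : y + t *: (x - y) = x + (1 - t) *: (y - x).
  by apply: vec_eq; rewrite !coordE; ring.
by apply: c; lra.
Qed.

(** The part of [A] off the boundary behaves like a union of connected components
of the complement of the boundary; moves along segments are all that the walk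
around the polygon uses. *)
Definition stable A := forall x y, clear x y -> A x -> A y.

Lemma stable_inside : stable (inside P).
Proof.
move=> x y c [Bx bx].
have C1 : connected_component (~` boundary P) x y.
  apply: (@connected_component_max _ _ ((fun t : R => x + t *: (y - x)) @` `[0, 1])).
  - by exists 0; rewrite ?scale0r ?addr0//= in_itv/= lexx ler01.
  - by move=> _ [t + <-]; rewrite /= in_itv /=; exact: c.
  - apply: connected_interval_image; first exact: interval_is_interval.
    exact: affine_continuous.
  - exists 1; first by rewrite /= in_itv /= ler01 lexx.
    by rewrite scale1r addrC subrK.
split; first exact: (connected_component_sub C1).
by rewrite -(same_connected_component C1).
Qed.

Lemma stable_not_inside : stable (~` inside P).
Proof. by move=> x y c; apply: contra_not; exact/stable_inside/clear_sym. Qed.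

(** A ray that misses the boundary makes the component of its origin unbounded. *)
Lemma ray_not_inside x u : u != 0 ->
  (forall t : R, 0 <= t -> ~ boundary P (x + t *: u)) -> ~ inside P x.
Proof.
move=> u0 ray [_ bx].
have sub : (fun t : R => x + t *: u) @` `[0, +oo[ `<=`
    connected_component (~` boundary P) x.
  apply: connected_component_max.
  - by exists 0; rewrite ?scale0r ?addr0//= in_itv/= lexx.
  - by move=> _ [t + <-]; rewrite /= in_itv /= andbT; exact: ray.
  - apply: connected_interval_image; first exact: interval_is_interval.
    exact: affine_continuous.
have [M M0 bM] := @ex_strict_bound_gt0 _ _ _ _ _ _ bx.
have nu : 0 < `|u| by rewrite normr_gt0.
pose t := (M + `|x|) / `|u|.
have t0 : 0 <= t by rewrite divr_ge0// addr_ge0// ltW.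
have /bM /= : connected_component (~` boundary P) x (x + t *: u).
  by apply: sub; exists t => //; rewrite /= in_itv /= t0.
apply/negP; rewrite -leNgt.
have : `|t *: u| <= `|x + t *: u| + `|x|.
  by apply: le_trans (ler_normB _ _); rewrite [x + _]addrC addrK.
by rewrite normrZ ger0_norm// divfK ?gt_eqF// lerD2r.
Qed.

End Components.

(** * Sectors at a vertex *)

Section Sector.
Context {R : realType}.
Implicit Types (a b u v : R * R) (k sg t : R).

(** For [sg = 1], the open sector swept counterclockwise from [a] to [b], and
for [sg = -1] the one swept clockwise; it is the intersection of two half
planes, or their union if its angle exceeds [pi]. *)
Definition sector sg a b u : bool :=
  if 0 <= sg * cross a b then (0 < sg * cross a u) && (0 < sg * cross u b)
  else (0 < sg * cross a u) || (0 < sg * cross u b).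

Lemma crossZl k u v : cross (k *: u) v = k * cross u v.
Proof. by rewrite /cross !coordE; ring. Qed.

Lemma crossZr k u v : cross u (k *: v) = k * cross u v.
Proof. by rewrite /cross !coordE; ring. Qed.

Lemma crossDl u v w : cross (u + v) w = cross u w + cross v w.
Proof. by rewrite /cross !coordE; ring. Qed.

Lemma cross_self u : cross u u = 0.
Proof. by rewrite /cross; ring. Qed.

Lemma cross_rot90 u : cross u (rot90 u) = dot u u.
Proof. by rewrite /cross /dot /=; ring. Qed.

Lemma cross_rot90l u v : cross (rot90 u) v = - dot u v.
Proof. by rewrite /cross /dot /=; ring. Qed.

Lemma dotC u v : dot u v = dot v u.
Proof. by rewrite /dot; ring. Qed.

Lemma sector_opp sg a b u : sector (- sg) b a u = sector sg a b u.
Proof.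
rewrite /sector (crossC b a) (crossC b u) (crossC u a) !mulrNN.
by rewrite [in RHS]andbC [in RHS]orbC.
Qed.

Lemma sector_scale sg a b k u : 0 < k -> sector sg a b (k *: u) = sector sg a b u.
Proof.
move=> k0; rewrite /sector crossZl crossZr !(mulrCA sg).
by rewrite !(pmulr_rgt0 _ k0).
Qed.

Lemma sector_ray sg a b k : 0 <= k -> ~~ sector sg a b (k *: a).
Proof.
move=> k0; rewrite /sector crossZl crossZr cross_self !mulr0 ltxx /=.
by case: ifPn => //; rewrite -ltNge mulrCA -leNgt => h; rewrite mulr_ge0_le0// ltW.
Qed.

Lemma sector_ray_end sg a b k : 0 <= k -> ~~ sector sg a b (k *: b).
Proof. by move=> k0; rewrite -sector_opp sector_ray. Qed.

Lemma conv_gt0 (x y t : R) : 0 < x -> 0 < y -> 0 <= t <= 1 -> 0 < x + t * (y - x).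
Proof. by move=> x0 y0 /andP[t0 t1]; nra. Qed.

Lemma sector_convex sg a b u v t : 0 <= sg * cross a b -> 0 <= t <= 1 ->
  sector sg a b u -> sector sg a b v -> sector sg a b (u + t *: (v - u)).
Proof.
move=> ab t01; rewrite /sector ab => /andP[u1 u2] /andP[v1 v2].
apply/andP; split.
  rewrite (_ : sg * _ = sg * cross a u + t * (sg * cross a v - sg * cross a u)).
    exact: conv_gt0.
  by rewrite /cross !coordE; ring.
rewrite (_ : sg * _ = sg * cross u b + t * (sg * cross v b - sg * cross u b)).
  exact: conv_gt0.
by rewrite /cross !coordE; ring.
Qed.

Lemma half_plane_sector sg a b u v t : sg * cross a b < 0 -> 0 <= t <= 1 ->
  0 < sg * cross a u -> 0 < sg * cross a v -> sector sg a b (u + t *: (v - u)).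
Proof.
move=> ab t01 u1 v1; rewrite /sector leNgt ab /=; apply/orP; left.
rewrite (_ : sg * _ = sg * cross a u + t * (sg * cross a v - sg * cross a u)).
  exact: conv_gt0.
by rewrite /cross !coordE; ring.
Qed.

Lemma half_plane_sector_end sg a b u v t : sg * cross a b < 0 -> 0 <= t <= 1 ->
  0 < sg * cross u b -> 0 < sg * cross v b -> sector sg a b (u + t *: (v - u)).
Proof.
move=> ab t01 u1 v1; rewrite -sector_opp; apply: half_plane_sector => //.
- by rewrite crossC mulrNN.
- by rewrite crossC mulrNN.
- by rewrite crossC mulrNN.
Qed.

(** Turning [a] by a small angle to the side given by [sg] enters the sector. *)
Lemma sector_tilt sg a b : sg != 0 -> a != 0 -> (cross a b = 0 -> dot a b < 0) ->
  exists2 mu, 0 < mu & forall nu, 0 < nu < mu ->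
    sector sg a b (a + nu *: (sg *: rot90 a)).
Proof.
move=> sg0 a0 ab.
have sg2 : 0 < sg * sg by rewrite -expr2 exprn_even_gt0.
have E1 nu : sg * cross a (a + nu *: (sg *: rot90 a)) = nu * (sg * sg * dot a a).
  by rewrite crossDr !crossZr cross_self cross_rot90; ring.
have E2 nu : sg * cross (a + nu *: (sg *: rot90 a)) b
    = sg * cross a b - nu * (sg * sg * dot a b).
  by rewrite crossDl !crossZl cross_rot90l; ring.
have pos nu : 0 < nu -> 0 < nu * (sg * sg * dot a a).
  by move=> nu0; apply: mulr_gt0 => //; apply: mulr_gt0 => //; exact: dot_gt0.
case: (ltgtP 0 (sg * cross a b)) => c.
- pose D := sg * sg * `|dot a b| + 1.
  have D0 : 0 < D by rewrite ltr_wpDl// mulr_ge0// ltW.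
  exists (sg * cross a b / D); first exact: divr_gt0.
  move=> nu /andP[nu0]; rewrite ltr_pdivlMr// => nuD.
  rewrite /sector (ltW c) E1 E2 pos//= subr_gt0; apply: le_lt_trans nuD.
  rewrite ler_pM2l//; apply: (@le_trans _ _ (sg * sg * `|dot a b|)).
    by rewrite ler_pM2l// ler_norm.
  by rewrite lerDl.
- exists 1 => // nu /andP[nu0 _].
  by rewrite /sector leNgt c E1 pos.
exists 1 => // nu /andP[nu0 _].
have c0 : cross a b = 0 by apply/eqP; move/eqP: c; rewrite eq_sym mulf_eq0 (negbTE sg0).
rewrite /sector -c lexx E1 E2 pos//= -c sub0r oppr_gt0.
by rewrite pmulr_rlt0// pmulr_rlt0// ab.
Qed.

(** Pushing a vector in the direction of [a], on the side of [a] where the sector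
begins, does not make it leave the sector. *)
Lemma sector_slide sg a b v k t : 0 < k -> k <= t -> 0 < sg * cross a v ->
  sector sg a b (a + v) -> sector sg a b (t *: a + k *: v).
Proof.
move=> k0 kt av; rewrite /sector.
have E1 : sg * cross a (t *: a + k *: v) = k * (sg * cross a v).
  by rewrite /cross !coordE; ring.
have E2 : sg * cross (t *: a + k *: v) b
    = (t - k) * (sg * cross a b) + k * (sg * cross (a + v) b).
  by rewrite /cross !coordE; ring.
case: ifP => ab; last by move=> _; rewrite E1 mulr_gt0.
move=> /andP[_ h]; rewrite E1 E2 mulr_gt0//=.
by apply: ltr_wpDl; [rewrite mulr_ge0// subr_ge0|exact: mulr_gt0].
Qed.

End Sector.

Section Local.
Context {R : realType} {n : nat} (P : 'I_n -> R * R).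
Hypothesis hP : simple_polygon P.
Implicit Types (i j : 'I_n) (u v x y : R * R) (A : set (R * R)) (sg r t k : R).

Definition back i : R * R := P (ord_pred i) - P i.

Lemma back_edge i : back i = - edge P (ord_pred i).
Proof. by rewrite /back /edge ord_predK opprB. Qed.

Lemma back_ordS i : back (ordS i) = - edge P i.
Proof. by rewrite back_edge ordSK. Qed.

Lemma back_neq0 i : back i != 0.
Proof. by rewrite back_edge oppr_eq0 edge_neq0. Qed.

Lemma vertex_antiparallel i : cross (edge P i) (back i) = 0 ->
  dot (edge P i) (back i) < 0.
Proof.
rewrite back_edge crossNr dotNr -crossC oppr_lt0 dotC => c.
by have := @no_half_turn _ _ _ hP (ord_pred i); rewrite ord_predK; apply.
Qed.

Lemma side_ray i v : side P i (P i + v) ->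
  exists2 k, 0 <= k & v = k *: edge P i.
Proof. by move=> /sideP[t /andP[t0 _] /addrI->]; exists t. Qed.

Lemma side_ray_back i v : side P (ord_pred i) (P i + v) ->
  exists2 k, 0 <= k & v = k *: back i.
Proof.
move=> /sideP[t /andP[_ t1] h]; exists (1 - t); first by rewrite subr_ge0.
have -> : v = P i + v - P i by rewrite addrC addKr.
rewrite h /back -(ord_predK i) /edge ordSK.
by apply: vec_eq; rewrite !coordE; ring.
Qed.

(** The sides other than the two at [P i] are at a positive distance of [P i]. *)
Lemma vertex_star i : exists2 r, 0 < r & forall v, `|v| < r ->
  boundary P (P i + v) ->
  (exists2 k, 0 <= k & v = k *: edge P i) \/ (exists2 k, 0 <= k & v = k *: back i).
Proof.
pose Q j v := side P j (P i + v) ->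
  (exists2 k, 0 <= k & v = k *: edge P i) \/ (exists2 k, 0 <= k & v = k *: back i).
have [|r r0 rQ] := @finite_radius _ _ Q.
  move=> j; have [->|ji] := eqVneq j i.
    by exists 1 => // v _ /side_ray; left.
  have [->|jpi] := eqVneq j (ord_pred i).
    by exists 1 => // v _ /side_ray_back; right.
  have Sji : ordS j != i by apply: contra_neq jpi => <-; rewrite ordSK.
  have [|r r0 hr] := @disjoint_segments_radius _ (P i) (P j) 0 (edge P j).
    move=> s t s01 t01; rewrite scaler0 addr0; apply/eqP => h.
    by apply: (vertex_notin_side hP ji Sji); rewrite h; exact: side_mem.
  exists r => // v /hr {}hr /sideP[t t01 h]; exfalso.
  have := hr 0 t; rewrite scaler0 addr0 h eqxx lexx ler01 => /(_ isT t01).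
  by [].
by exists r => // v vr [j _ sj]; exact: rQ sj.
Qed.

(** Near a vertex the boundary consists of two rays, so a segment that stays in
one of the two sectors misses it. *)
Lemma sector_clear i : exists2 r, 0 < r & forall sg u v, `|u| < r -> `|v| < r ->
  (forall t, 0 <= t <= 1 -> sector sg (edge P i) (back i) (u + t *: (v - u))) ->
  clear P (P i + u) (P i + v).
Proof.
have [r r0 star] := vertex_star i; exists r => // sg u v ur vr sec t t01.
have -> : P i + u + t *: (P i + v - (P i + u)) = P i + (u + t *: (v - u)).
  by apply: vec_eq; rewrite !coordE; ring.
move=> B; have := sec t t01.
have [|[k k0 ->]|[k k0 ->]] := star _ _ B; last 2 first.
- by apply/negP; exact: sector_ray.
- by apply/negP; exact: sector_ray_end.
have -> : u + t *: (v - u) = (1 - t) *: u + t *: v.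
  by apply: vec_eq; rewrite !coordE; ring.
move/andP: t01 => [t0 t1].
apply: le_lt_trans (ler_normD _ _) _; rewrite !normrZ !ger0_norm ?subr_ge0//.
have [->|tn0] := eqVneq t 0; first by rewrite subr0 mul1r mul0r addr0.
have : 0 < t by rewrite lt_neqAle eq_sym tn0.
by move=> tp; nra.
Qed.

Definition meets sg A i := forall r, 0 < r ->
  exists u, [/\ sector sg (edge P i) (back i) u, `|u| < r & A (P i + u)].

Definition fills sg A i := exists2 r, 0 < r & forall u,
  sector sg (edge P i) (back i) u -> `|u| < r -> A (P i + u).

Lemma small_scale u r : 0 < r -> \forall e \near (0 : R)^'+, `|e *: u| < r.
Proof.
move=> r0; have d0 : 0 < `|u| + 1 by rewrite ltr_wpDl.
apply/near0_rightP; exists (r / (`|u| + 1)); first exact: divr_gt0.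
move=> e /andP[e0]; rewrite ltr_pdivlMr// normrZ gtr0_norm//; apply: le_lt_trans.
by rewrite ler_pM2l// lerDl.
Qed.

(** A sector is connected through segments: it is convex, or the union of two
half planes that both contain [- (a + b)]. *)
Lemma meets_fills sg A i : stable P A -> meets sg A i -> fills sg A i.
Proof.
move=> stA mt; have [r r0 cl] := sector_clear i; exists r => // u su ur.
have [v [sv vr Av]] := mt r r0.
case: (lerP 0 (sg * cross (edge P i) (back i))) => ab.
  by apply: stA Av; apply: (cl sg) => // t t01; exact: sector_convex.
pose mid := - (edge P i + back i).
near (0 : R)^'+ => e.
have e0 : 0 < e by [].
have mr : `|e *: mid| < r by near: e; exact: small_scale.
have m1 : 0 < sg * cross (edge P i) (e *: mid).
  rewrite crossZr crossNr crossDr cross_self add0r mulrCA pmulr_rgt0//.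
  by rewrite mulrN oppr_gt0.
have m2 : 0 < sg * cross (e *: mid) (back i).
  rewrite crossZl crossNl crossDl cross_self addr0 mulrCA pmulr_rgt0//.
  by rewrite mulrN oppr_gt0.
have clm w : sector sg (edge P i) (back i) w -> `|w| < r ->
    clear P (P i + w) (P i + e *: mid).
  rewrite /sector leNgt ab /= => /orP[w1|w2] wr; apply: (cl sg) => // t t01.
    exact: half_plane_sector.
  exact: half_plane_sector_end.
have Am : A (P i + e *: mid) by apply: stA Av; exact: clm.
by apply: stA Am; apply/clear_sym/clm.
Unshelve. all: by end_near. Qed.

Lemma fills_near sg A i u : fills sg A i -> sector sg (edge P i) (back i) u ->
  \forall e \near (0 : R)^'+, A (P i + e *: u).
Proof.
move=> [r r0 h] su; near=> e; apply: h; last by near: e; exact: small_scale.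
by rewrite sector_scale.
Unshelve. all: by end_near. Qed.

Lemma ray_meets sg A i u : sector sg (edge P i) (back i) u ->
  (forall e : R, 0 < e -> A (P i + e *: u)) -> meets sg A i.
Proof.
move=> su h r r0; near (0 : R)^'+ => e; exists (e *: u); split.
- by rewrite sector_scale.
- by near: e; exact: small_scale.
- by apply: h.
Unshelve. all: by end_near. Qed.

(** A segment parallel to side [i] and close to it leads from the sector at one
end of the side to the sector at the other end. *)
Lemma meets_ordS sg A i : sg != 0 -> stable P A -> meets sg A i -> meets sg A (ordS i).
Proof.
move=> sg0 stA /(meets_fills stA)[r r0 fil] r' r'0.
set a := edge P i in fil *.
have a0 : a != 0 by exact: edge_neq0.
have [mu1 mu10 tilt1] := sector_tilt sg0 a0 (@vertex_antiparallel i).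
have [|||mu2 mu20 tilt2] := @sector_tilt _ (- sg) (back (ordS i)) (edge P (ordS i)).
- by rewrite oppr_eq0.
- exact: back_neq0.
- by rewrite crossC dotC => /eqP; rewrite oppr_eq0 => /eqP/vertex_antiparallel.
pose nu := Num.min mu1 mu2 / 2.
have nu0 : 0 < nu by rewrite divr_gt0// lt_min mu10.
have nu1 : nu < mu1.
  have : Num.min mu1 mu2 <= mu1 by rewrite ge_min lexx.
  by rewrite /nu; lra.
have nu2 : nu < mu2.
  have : Num.min mu1 mu2 <= mu2 by rewrite ge_min lexx orbT.
  by rewrite /nu; lra.
pose w := nu *: (sg *: rot90 a).
have aw : 0 < sg * cross a w.
  rewrite !crossZr cross_rot90 mulrCA pmulr_rgt0// mulrA -expr2.
  by rewrite mulr_gt0 ?dot_gt0// exprn_even_gt0.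
have s1 : sector sg a (back i) (a + w) by apply: tilt1; rewrite nu0.
have s2 : sector (- sg) (back (ordS i)) (edge P (ordS i)) (back (ordS i) + w).
  have -> : w = nu *: (- sg *: rot90 (back (ordS i))).
    by rewrite /w back_ordS; apply: vec_eq; rewrite !coordE /=; ring.
  by apply: tilt2; rewrite nu0.
pose Q j v := j != i -> ordS i != j -> ordS j != i -> forall t, 0 <= t <= 1 ->
  ~ side P j (P i + t *: a + v).
have [|d d0 dQ] := @finite_radius _ _ Q.
  move=> j; have [/andP[/andP[ji Sij] Sji]|bad] :=
      boolP ((j != i) && (ordS i != j) && (ordS j != i)); last first.
    by exists 1 => // v _ ji Sij Sji; move: bad; rewrite ji Sij Sji.
  have [|d d0 hd] := @disjoint_segments_radius _ (P i) (P j) a (edge P j).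
    by move=> s t s01 t01; apply: (sides_disjoint hP) => //; rewrite eq_sym.
  exists d => // v /hd {}hd _ _ _ t t01 /sideP[s s01 h].
  by have := hd t s t01 s01; rewrite h eqxx.
near (0 : R)^'+ => e.
have e0 : 0 < e by [].
have e12 : e < 1 / 2 by near: e; apply: nbhs_right_lt; lra.
have er : `|e *: (a + w)| < r by near: e; exact: small_scale.
have er' : `|e *: (back (ordS i) + w)| < r' by near: e; exact: small_scale.
have ed : `|e *: w| < d by near: e; exact: small_scale.
exists (e *: (back (ordS i) + w)); split => //.
  by rewrite sector_scale// -sector_opp.
have Au : A (P i + e *: (a + w)) by apply: fil; rewrite ?sector_scale.
apply: stA Au => t t01 [j _].
pose th := e + t * (1 - 2 * e).
have /andP[th1 th2] : e <= th <= 1 - e.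
  by move/andP: t01 => [? ?]; rewrite /th; apply/andP; split; nra.
have PS : P (ordS i) = P i + a by rewrite /a /edge addrC subrK.
have -> : P i + e *: (a + w) + t *: (P (ordS i) + e *: (back (ordS i) + w)
    - (P i + e *: (a + w))) = P i + (th *: a + e *: w).
  by rewrite back_ordS -/a PS /th; apply: vec_eq; rewrite !coordE; ring.
have sv := sector_slide e0 th1 aw s1.
have [->|ji] := eqVneq j i.
  by move=> /side_ray[k k0 h]; move: sv; rewrite h; apply/negP/sector_ray.
have [->|jSi] := eqVneq j (ordS i).
  have aw' : 0 < - sg * cross (back (ordS i)) w by rewrite back_ordS crossNl mulrNN.
  have e1 : e <= 1 - th by lra.
  have sv' := sector_slide e0 e1 aw' s2.
  have -> : P i + (th *: a + e *: w) = P (ordS i) + ((1 - th) *: back (ordS i) + e *: w).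
    by rewrite back_ordS -/a PS; apply: vec_eq; rewrite !coordE; ring.
  by move=> /side_ray[k k0 h]; move: sv'; rewrite h; apply/negP/sector_ray_end.
have [jpi|jpi] := eqVneq j (ord_pred i).
  rewrite jpi => /side_ray_back[k k0 h].
  by move: sv; rewrite h; apply/negP/sector_ray_end.
rewrite addrA; apply: (dQ j) => //.
- by rewrite eq_sym.
- by apply: contra_neq jpi => <-; rewrite ordSK.
- by lra.
Unshelve. all: by end_near. Qed.

Lemma meets_everywhere sg A m i : sg != 0 -> stable P A -> meets sg A m -> meets sg A i.
Proof.
move=> sg0 stA mt; have [q ->] : exists q, i = iter q (@ordS n) m.
  exists ((i + (n - m)) %% n)%N; apply/val_inj; rewrite /= val_iter_ordS modnDmr.
  by rewrite addnCA subnKC 1?ltnW// modnDr modn_small.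
by elim: q => //= q IH; exact: meets_ordS.
Qed.

End Local.

(** * Orientation and total turning *)

Section Orientation.
Context {R : realType} {n : nat} (P : 'I_n -> R * R) (sg : R).
Hypothesis hP : simple_polygon P.
Hypothesis sg0 : sg != 0.

(** Covers both orientations: counterclockwise for [sg = 1], clockwise for
[sg = -1]. *)
Definition oriented := forall (i : 'I_n) (t : R), 0 < t < 1 ->
  \forall e \near (0 : R)^'+,
    inside P (P i + t *: edge P i + (sg * e) *: rot90 (edge P i)).

Hypothesis oP : oriented.
Implicit Types (i j m : 'I_n) (u v w x : R * R) (r t : R).

Lemma oriented_meets i : meets P sg (inside P) i.
Proof.
move=> r r0; set a := edge P i.
have [mu mu0 tilt] := sector_tilt sg0 (edge_neq0 hP i) (@vertex_antiparallel _ _ _ hP i).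
have r2 : 0 < r / 2 by rewrite divr_gt0.
near (0 : R)^'+ => t.
have t0 : 0 < t by [].
have t1 : t < 1 by near: t; exact: nbhs_right_lt ltr01.
have tr : `|t *: a| < r / 2 by near: t; exact: small_scale.
near (0 : R)^'+ => e.
have e0 : 0 < e by [].
have er : `|e *: (sg *: rot90 a)| < r / 2 by near: e; exact: small_scale.
have et : e < t * mu by near: e; apply: nbhs_right_lt; rewrite mulr_gt0.
exists (t *: a + e *: (sg *: rot90 a)); split.
- have -> : t *: a + e *: (sg *: rot90 a) = t *: (a + (e / t) *: (sg *: rot90 a)).
    by apply: vec_eq; rewrite !coordE /=; field; rewrite gt_eqF.
  rewrite sector_scale//; apply: tilt.
  by rewrite divr_gt0//= ltr_pdivrMr// mulrC.
- by apply: le_lt_trans (ler_normD _ _) _; lra.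
- rewrite addrA scalerA mulrC; near: e; apply: oP.
  by rewrite t0 t1.
Unshelve. all: by end_near. Qed.

Lemma inside_fills i : fills P sg (inside P) i.
Proof. exact/(meets_fills hP)/oriented_meets/stable_inside. Qed.

Section Lowest.
Variables (w : R * R) (m : 'I_n).
Hypothesis w0 : w != 0.
Hypothesis low : forall j, j != m -> up w (P j - P m).

Lemma upZ k u : 0 < k -> up w (k *: u) = up w u.
Proof.
move=> k0; rewrite /up crossZr pmulr_rgt0// mulf_eq0 gt_eqF//=.
have -> : dot w (k *: u) = k * dot w u by rewrite /dot !coordE; ring.
by rewrite pmulr_rgt0.
Qed.

Lemma boundary_up x : boundary P x -> x = P m \/ up w (x - P m).
Proof.
have lowW j : P j = P m \/ up w (P j - P m).
  by have [->|/low] := eqVneq j m; [left|right].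
case=> j _ /sideP[t /andP[t0 t1] ->].
move: t0; rewrite le_eqVlt => /orP[/eqP<-|t0].
  by rewrite scale0r addr0.
move: t1; rewrite le_eqVlt => /orP[/eqP->|t1].
  by rewrite scale1r /edge addrC subrK.
have -> : P j + t *: edge P j - P m
    = (1 - t) *: (P j - P m) + t *: (P (ordS j) - P m).
  by apply: vec_eq; rewrite !coordE; ring.
have t1' : 0 < 1 - t by rewrite subr_gt0.
case: (lowW j) (lowW (ordS j)) => [Ej|uj] [ESj|uSj].
- by left; rewrite /edge ESj Ej subrr scaler0 addr0.
- by right; rewrite Ej subrr scaler0 add0r upZ.
- by right; rewrite ESj subrr scaler0 addr0 upZ.
- by right; apply: upD; rewrite upZ.
Qed.

Let a := edge P m.
Let b := back P m.

Let up_a : up w a.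
Proof. by apply: low; exact: (ordS_neq hP). Qed.

Let up_b : up w b.
Proof.
apply: low; apply/eqP => h.
by have := ordS_neq hP m; rewrite -{1}h ord_predK eqxx.
Qed.

Lemma below_not_inside u e : up w (- u) -> 0 < e -> ~ inside P (P m + e *: u).
Proof.
move=> uu e0; have u0 : u != 0 by rewrite -oppr_eq0; exact: up_neq0 uu.
apply: (ray_not_inside u0) => t t0 /boundary_up.
have te : 0 < e + t by rewrite ltr_pwDl.
have -> : P m + e *: u + t *: u = P m + (e + t) *: u.
  by rewrite scalerDl addrA.
case=> [/eqP|].
  by rewrite addrC -subr_eq0 addrK scaler_eq0 (gt_eqF te) (negbTE u0).
rewrite addrC addKr upZ// => uu'.
by move: uu; rewrite upN// uu'.
Qed.

(** The points below the lowest vertex are outside, so the side of the boundary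
on which the interior lies tells how the polygon turns there. *)
Lemma lowest_turn : 0 < sg * cross a b.
Proof.
have um : up w (- - (a + b)) by rewrite opprK upD.
rewrite lt_neqAle; apply/andP; split; last first.
  rewrite leNgt; apply/negP => ab.
  have [|d d0 hd] := (near0_rightP _).1 (fills_near (inside_fills m) (u := - (a + b)) _).
    rewrite /sector leNgt ab /= crossNr crossDr cross_self add0r mulrN.
    by rewrite oppr_gt0 ab.
  apply: (below_not_inside um (e := d / 2)); first by rewrite divr_gt0.
  by apply: hd; lra.
rewrite eq_sym mulf_eq0 (negbTE sg0)/=; apply/eqP => c0.
have a0 : a != 0 by exact: edge_neq0.
have d0 := vertex_antiparallel hP c0.
have k0 : 0 < - (dot a b / dot a a).
  by rewrite oppr_gt0 pmulr_llt0// invr_gt0 dot_gt0.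
move: up_b; rewrite (collinear_scale a0 c0) -[_ / _]opprK scaleNr upN ?upZ ?up_a//.
by rewrite scaler_eq0 (gt_eqF k0).
Qed.

Lemma outside_meets_lowest : meets P (- sg) (~` inside P) m.
Proof.
apply: (@ray_meets _ _ _ _ _ _ (- (a + b))) => [|e e0].
  rewrite /sector mulNr oppr_ge0 leNgt lowest_turn /=.
  by rewrite crossNr crossDr cross_self add0r mulrNN lowest_turn.
by apply: below_not_inside; rewrite // opprK upD.
Qed.

End Lowest.

(** The sector opposite to the interior is exterior at the lowest vertex, and
walking along the sides shows that it is exterior at all vertices. *)
Lemma outside_fills i : fills P (- sg) (~` inside P) i.
Proof.
have w0 := edge_neq0 hP i; have [m low] := lowest_vertex hP w0.
apply: (meets_fills hP); first exact: stable_not_inside.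
apply: (meets_everywhere hP _ _ _ (outside_meets_lowest w0 low)).
  by rewrite oppr_eq0.
exact: stable_not_inside.
Qed.

Lemma total_turning w : w != 0 ->
  \sum_i crossing w (edge P (ord_pred i)) (edge P i) = 2 * sgz sg.
Proof.
move=> w0; have [m low] := lowest_vertex hP w0.
rewrite (crossing_sum hP w0 low); congr (_ * _).
apply/esym/sgz_mul_gt0.
by have := lowest_turn w0 low; rewrite back_edge crossNr -crossC.
Qed.

End Orientation.

(** * Convexity and reflex vertices *)

Lemma changes_ge (d : nat -> bool) p q : (p <= q)%N ->
  ((d p != d q) <= \sum_(p <= k < q) (d k != d k.+1))%N.
Proof.
elim: q => [|q IH]; first by rewrite leqn0 => /eqP->; rewrite eqxx.
rewrite leq_eqVlt => /orP[/eqP->|]; first by rewrite eqxx.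
rewrite ltnS => pq; rewrite big_nat_recr//=.
by have := IH pq; case: (d p) (d q) (d q.+1) => -[] [] //=; lia.
Qed.

(** A sequence that changes only once cannot change on two of the three
intervals delimited by [p] and [q]. *)
Lemma one_change (d : nat -> bool) N p q : (p <= q)%N -> (q <= N)%N ->
  (\sum_(0 <= k < N) (d k != d k.+1) <= 1)%N ->
  ((d 0%N != d p) + (d p != d q) + (d q != d N) <= 1)%N.
Proof.
move=> pq qN; apply: leq_trans.
rewrite (big_cat_nat (leq0n q) qN) (big_cat_nat (leq0n p) pq) /=.
by rewrite !leq_add// changes_ge.
Qed.

Lemma convex_set_segment {R : realType} (A : set (R * R)) :
  convex_set A <-> forall x y (t : R), 0 <= t <= 1 -> A x -> A y ->
    A (x + t *: (y - x)).
Proof.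
split=> [cA x y t /andP[t0 t1] Ax Ay|cA x y l].
  have t1' : 0 <= 1 - t by rewrite subr_ge0.
  have t0' : 1 - t <= 1 by rewrite gerBl.
  have := cA x y (Itv01 t1' t0'); rewrite !inE => /(_ Ax Ay).
  rewrite /conv/= /unstable.onem.
  by congr (A _); apply: vec_eq; rewrite !coordE; ring.
rewrite !inE => Ax Ay.
have -> : conv l x y = (x : R * R) + (1 - l%:num) *: ((y : R * R) - x).
  by apply: vec_eq; rewrite !coordE /= /unstable.onem; ring.
apply: cA => //; rewrite subr_ge0 le1 /=.
by rewrite gerBl ge0.
Qed.

Section Convexity.
Context {R : realType} {n : nat} (P : 'I_n -> R * R) (sg : R).
Hypothesis hP : simple_polygon P.
Hypothesis sg0 : sg != 0.
Hypothesis oP : oriented P sg.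
Implicit Types (i j m : 'I_n) (u v w x y : R * R) (r t : R).

Definition no_reflex := forall i, 0 <= sg * cross (edge P i) (back P i).

Lemma sideW i x : side P i x -> boundary P x. Proof. by exists i. Qed.

(** A short segment joining the two sides at a reflex vertex would cross the
exterior sector, which is convex. *)
Lemma convex_no_reflex : convex_polygon P -> no_reflex.
Proof.
move=> /convex_set_segment cP i; rewrite leNgt; apply/negP => ab.
set a := edge P i in ab *; set b := back P i in ab *.
have s_ab : sector (- sg) a b (a + b).
  rewrite /sector mulNr oppr_ge0 (ltW ab) crossDr crossDl !cross_self add0r addr0.
  by rewrite mulNr oppr_gt0 ab.
have [r r0 star] := vertex_star hP i.
near (0 : R)^'+ => e.
have e0 : 0 < e by [].
have e12 : e < 1 / 2 by near: e; apply: nbhs_right_lt; lra.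
have er : `|e *: (a + b)| < r by near: e; exact: small_scale.
have out : (~` inside P) (P i + e *: (a + b)).
  by near: e; exact: (fills_near (outside_fills hP sg0 oP i)).
have bnd : ~ boundary P (P i + e *: (a + b)).
  move=> /(star _ er)[] [k k0 h]; have := s_ab; rewrite -(sector_scale _ _ _ _ e0) h.
    by apply/negP; exact: sector_ray.
  by apply/negP; exact: sector_ray_end.
have : (boundary P `|` inside P) (P i + e *: (a + b)).
  have -> : P i + e *: (a + b) = (P i + (2 * e) *: a) +
      (1 / 2 : R) *: ((P i + (2 * e) *: b) - (P i + (2 * e) *: a)).
    by apply: vec_eq; rewrite !coordE; field.
  apply: cP; first by lra.
    by left; apply/sideW/side_mem; lra.
  left; apply: (@sideW (ord_pred i)).
  have -> : P i + (2 * e) *: b = P (ord_pred i) + (1 - 2 * e) *: edge P (ord_pred i).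
    by rewrite /b /back /edge ord_predK; apply: vec_eq; rewrite !coordE; ring.
  by apply: side_mem; lra.
by case.
Unshelve. all: by end_near. Qed.

Hypothesis nr : no_reflex.

Lemma turn_ge0 i : 0 <= sg * cross (edge P i) (edge P (ordS i)).
Proof. by have := nr (ordS i); rewrite back_ordS crossNr -crossC. Qed.

(** Without reflex vertices no crossing can cancel another one. *)
Lemma crossing_no_reflex w i : w != 0 ->
  crossing w (edge P (ord_pred i)) (edge P i)
  = sgz sg * (up w (edge P (ord_pred i)) != up w (edge P i))%:Z.
Proof.
move=> w0; rewrite /crossing; case: eqP => [_|ud] /=; first by rewrite mulr0.
rewrite mulr1; apply/esym/sgz_mul_gt0.
have := turn_ge0 (ord_pred i); rewrite ord_predK le_eqVlt => /orP[|//].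
rewrite eq_sym mulf_eq0 (negbTE sg0) /= => /eqP c0; exfalso; apply: ud.
have e0 := edge_neq0 hP (ord_pred i).
have d0 : 0 < dot (edge P (ord_pred i)) (edge P i).
  by have := @no_half_turn _ _ _ hP (ord_pred i); rewrite ord_predK; apply.
by rewrite (collinear_scale e0 c0) upZ// divr_gt0// dot_gt0.
Qed.

(** Call the direction of side [i] horizontal.  From the lowest vertex on, the
sides first go up and then down, as the total turning leaves room for two
changes only.  Inside the run of side [i], walk from this side to the lowest
vertex, backwards if [sg] is positive and forwards if it is negative: the sense
of the turns forces all the sides on the way to be horizontal, so that [P i] is
as low as the lowest vertex. *)
Lemma all_on_one_side i j : 0 <= sg * cross (edge P i) (P j - P i).
Proof.
have e0 := edge_neq0 hP i; pose w := sg *: edge P i.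
have w0 : w != 0 by rewrite scaler_eq0 negb_or sg0.
have [m low] := lowest_vertex hP w0.
pose nx k := iter k (@ordS n) m.
pose d k := up w (edge P (nx k)).
have n2 : (2 < n)%N by case: hP.
have ppos : ord_pred m != m.
  by apply/eqP => h; have := ordS_neq hP m; rewrite -{1}h ord_predK eqxx.
have d0 : d 0%N by apply: low; exact: (ordS_neq hP).
have dN : d n.-1 = false.
  have -> : d n.-1 = up w (edge P (ord_pred m)).
    rewrite /d; congr (up w (edge P _)); apply: ordS_inj; rewrite ord_predK.
    by rewrite -iterS iter_ordS_n// prednK// (ltn_trans _ n2).
  have := low _ ppos; rewrite -/(back P m) back_edge upN ?(edge_neq0 hP)//.
  exact: negbTE.
have nn : n.-1.+1 = n by rewrite prednK// (ltn_trans _ n2).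
have total : (\sum_(0 <= k < n.-1) (d k != d k.+1) <= 1)%N.
  have := total_turning hP sg0 oP w0.
  rewrite (eq_bigr _ (fun k _ => crossing_no_reflex k w0)).
  rewrite -big_distrr /= mulrC => /mulIf.
  rewrite sgz_eq0 => /(_ sg0).
  rewrite -(sum_iter_ordS m _ nn) big_nat_recl//=.
  have -> : up w (edge P (ord_pred m)) != up w (edge P m).
    have -> : up w (edge P m) = true := d0.
    have := low _ ppos; rewrite -/(back P m) back_edge upN ?(edge_neq0 hP)//.
    by move/negbTE->.
  rewrite (eq_bigr (fun k => (d k != d k.+1)%:Z)); last first.
    by move=> k _; rewrite /= ordSK.
  by rewrite -(big_morph Posz PoszD erefl); lia.
have [k0 k0n ik0] : exists2 k, (k < n)%N & i = nx k.
  exists ((i + (n - m)) %% n)%N; first by rewrite ltn_pmod// (ltn_trans _ n2).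
  apply/val_inj; rewrite /= val_iter_ordS modnDmr.
  by rewrite addnCA subnKC 1?ltnW// modnDr modn_small.
have k0N : (k0 <= n.-1)%N by rewrite -ltnS nn.
have up_ge0 u : up w u -> 0 <= cross w u.
  by case/orP => [/ltW//|/andP[/eqP->]].
have down_le0 u : up w u = false -> cross w u <= 0.
  by move=> /negbT; rewrite negb_or -leNgt => /andP[].
have wi : cross w (edge P i) = 0 by rewrite crossZl cross_self mulr0.
have dk0 : d k0 = (0 < sg).
  rewrite /d -ik0 /up wi ltxx eqxx /=.
  have -> : dot w (edge P i) = sg * dot (edge P i) (edge P i).
    by rewrite /dot !coordE; ring.
  by rewrite pmulr_lgt0// dot_gt0.
have turnl l : 0 <= sg * cross (edge P (nx l)) (edge P (nx l.+1)) := turn_ge0 (nx l).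
have step u v : cross w u = 0 -> sg * cross u v = (sg * (dot w u / dot w w)) * cross w v.
  by move=> c0; rewrite [in LHS](collinear_scale w0 c0) crossZl mulrA.
have dw := dot_gt0 w0.
have level : cross w (P i - P m) = 0.
  have [sgp|sgn] : 0 < sg \/ sg < 0 by move: sg0; rewrite neq_lt => /orP[]; [right|left].
    have dl l : (l <= k0)%N -> d l.
      move=> lk; have := one_change lk k0N total; rewrite d0 dN dk0 sgp.
      by case: (d l).
    have hor q : (q <= k0)%N -> cross w (edge P (nx (k0 - q)%N)) = 0.
      elim: q => [|q IH] qk; first by rewrite subn0 -ik0.
      have h := IH (ltnW qk); have E : (k0 - q = (k0 - q.+1).+1)%N by lia.
      apply/eqP; rewrite eq_le up_ge0 ?andbT; last exact/dl/leq_subr.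
      have := turnl (k0 - q.+1)%N; rewrite -E crossC mulrN step// oppr_ge0.
      rewrite pmulr_rle0// mulr_gt0// divr_gt0//.
      by have := dl _ (leq_subr q k0); rewrite /d /up h ltxx eqxx.
    have : forall k, (k <= k0)%N -> cross w (P (nx k) - P m) = 0.
      elim=> [|k IH] kk; first by rewrite subrr /cross /= !mulr0 subrr.
      have -> : P (nx k.+1) - P m = edge P (nx k) + (P (nx k) - P m).
        by rewrite /edge addrA subrK.
      rewrite crossDr IH 1?ltnW// addr0.
      by have := hor (k0 - k)%N (leq_subr _ _); rewrite subKn// ltnW.
    by move=> /(_ k0 (leqnn _)); rewrite -ik0.
  have dl l : (k0 <= l)%N -> (l <= n.-1)%N -> d l = false.
    move=> kl ln; have := one_change kl ln total; rewrite d0 dN dk0 ltNge (ltW sgn).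
    by case: (d l).
  have hor q : (k0 + q <= n.-1)%N -> cross w (edge P (nx (k0 + q)%N)) = 0.
    elim: q => [|q IH] qk; first by rewrite addn0 -ik0.
    rewrite addnS in qk *; have h := IH (ltnW qk).
    apply/eqP; rewrite eq_le down_le0 /=; last by apply: (dl (k0 + q).+1); lia.
    have := turnl (k0 + q)%N; rewrite step//.
    rewrite pmulr_rge0// nmulr_rgt0// pmulr_llt0 ?invr_gt0//.
    have := dl _ (leq_addr q k0) (ltnW qk); rewrite /d /up h ltxx eqxx /= => /negbT.
    rewrite -leNgt le_eqVlt => /orP[/eqP du|//].
    by have := edge_neq0 hP (nx (k0 + q)%N); rewrite (cross_dot_eq0 w0 h du) eqxx.
  have : forall q, (k0 + q <= n)%N -> cross w (P (nx (k0 + q)%N) - P i) = 0.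
    elim=> [|q IH] qn; first by rewrite addn0 -ik0 subrr /cross /= !mulr0 subrr.
    rewrite addnS in qn *.
    have -> : P (nx (k0 + q).+1%N) - P i = edge P (nx (k0 + q)%N) + (P (nx (k0 + q)%N) - P i).
      by rewrite /edge addrA subrK.
    by rewrite crossDr IH 1?ltnW// addr0 hor// -ltnS nn.
  move=> /(_ (n - k0)%N); rewrite (subnKC (ltnW k0n)) => /(_ (leqnn _)).
  by rewrite /nx iter_ordS_n// -opprB crossNr => /eqP; rewrite oppr_eq0 => /eqP.
have -> : sg * cross (edge P i) (P j - P i) = cross w (P j - P m) - cross w (P i - P m).
  by rewrite /w /cross !coordE; ring.
rewrite level subr0; have [->|/low/up_ge0//] := eqVneq j m.
by rewrite subrr /cross /= !mulr0 subrr.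
Qed.

Definition side_half_planes x := forall i, 0 <= sg * cross (edge P i) (x - P i).

Lemma boundary_half_planes x : boundary P x -> side_half_planes x.
Proof.
case=> j _ /sideP[t /andP[t0 t1] ->] i.
have -> : sg * cross (edge P i) (P j + t *: edge P j - P i)
    = (1 - t) * (sg * cross (edge P i) (P j - P i))
      + t * (sg * cross (edge P i) (P (ordS j) - P i)).
  by rewrite /cross !coordE; ring.
by rewrite addr_ge0// mulr_ge0 ?subr_ge0// all_on_one_side.
Qed.

(** From a point beyond one of the sides, a ray orthogonal to this side never
meets the polygon. *)
Lemma inside_half_planes x : inside P x -> side_half_planes x.
Proof.
move=> Px i; rewrite leNgt; apply/negP => xi; move: Px.
pose u := - (sg *: rot90 (edge P i)).
have ui : sg * cross (edge P i) u = - (sg * sg * dot (edge P i) (edge P i)).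
  by rewrite crossNr crossZr cross_rot90; ring.
have d0 := dot_gt0 (edge_neq0 hP i).
have u0 : u != 0.
  apply: contra_neq sg0 => u0; move: ui; rewrite u0 /cross /= !mulr0 subr0 mulr0.
  move/esym/eqP; rewrite oppr_eq0 !mulf_eq0 orbb (gt_eqF d0) orbF.
  by move/eqP.
apply: (ray_not_inside u0) => t t0 /boundary_half_planes/(_ i); apply/negP.
rewrite -ltNge.
have -> : sg * cross (edge P i) (x + t *: u - P i)
    = sg * cross (edge P i) (x - P i) + t * (sg * cross (edge P i) u).
  by rewrite /cross !coordE; ring.
rewrite ui mulrN subr_lt0; apply: lt_le_trans xi _.
apply: mulr_ge0 => //; apply: mulr_ge0; last exact: ltW.
by rewrite -expr2 sqr_ge0.
Qed.

Lemma boundary_radius x : ~ boundary P x ->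
  exists2 r, 0 < r & forall v, `|v| < r -> ~ boundary P (x + v).
Proof.
move=> Bx; have [|r r0 h] := @finite_radius _ _ (fun j v => ~ side P j (x + v)).
  move=> j; have [|r r0 h] := @disjoint_segments_radius _ x (P j) 0 (edge P j).
    move=> s t s01 t01; rewrite scaler0 addr0; apply/eqP => xj.
    by apply/Bx/sideW; rewrite xj; exact: side_mem.
  exists r => // v /h{}h /sideP[t t01 xj].
  have := h 0 t; rewrite scaler0 addr0 xj eqxx lexx ler01.
  by move=> /(_ isT t01).
by exists r => // v vr [j _]; exact: h.
Qed.

(** An interior point on the line of a side could be moved slightly beyond it
without meeting the boundary. *)
Lemma inside_open_half_planes x i : inside P x -> 0 < sg * cross (edge P i) (x - P i).
Proof.
move=> Px; rewrite lt_neqAle (inside_half_planes Px) andbT eq_sym; apply/eqP => xi.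
have [r r0 Br] := boundary_radius Px.1.
pose u := - (sg *: rot90 (edge P i)).
near (0 : R)^'+ => e.
have e0 : 0 < e by [].
have er : `|e *: u| < r by near: e; exact: small_scale.
have : inside P (x + e *: u).
  apply: stable_inside Px => t /andP[t0 t1].
  have -> : x + e *: u - x = e *: u by rewrite addrAC subrr add0r.
  apply: Br; rewrite normrZ ger0_norm//.
  by apply: le_lt_trans er; rewrite ler_piMl.
move=> /inside_half_planes/(_ i); apply/negP; rewrite -ltNge.
have -> : sg * cross (edge P i) (x + e *: u - P i)
    = sg * cross (edge P i) (x - P i) - e * (sg * sg * dot (edge P i) (edge P i)).
  by rewrite /u /cross /dot !coordE /=; ring.
rewrite xi sub0r oppr_lt0; apply: mulr_gt0 => //; apply: mulr_gt0.
  by rewrite -expr2 exprn_even_gt0.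
exact/dot_gt0/edge_neq0.
Unshelve. all: by end_near. Qed.

(** A segment from an interior point to a point of the intersection of the
closed half planes stays in the open half planes, hence off the boundary, up
to its last point. *)
Lemma region_half_planes : boundary P `|` inside P = side_half_planes.
Proof.
apply/seteqP; split=> [x [|]|x Kx].
- exact: boundary_half_planes.
- exact: inside_half_planes.
have [Bx|Bx] := pselect (boundary P x); [by left|right].
have n2 : (2 < n)%N by case: hP.
have i0 : 'I_n := Ordinal (ltnW (ltnW n2)).
have [y Py] : exists y, inside P y.
  have h12 : 0 < (1 / 2 : R) < 1 by lra.
  have [d d0 hd] := (near0_rightP _).1 (oP i0 h12).
  by eexists; apply: (hd (d / 2)); lra.
apply: (stable_inside _ Py) => t /andP[t0]; rewrite le_eqVlt => /orP[/eqP->|t1].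
  by rewrite scale1r addrC subrK.
case=> j _ /sideP[s _ h].
have : 0 < sg * cross (edge P j) (y + t *: (x - y) - P j).
  have -> : sg * cross (edge P j) (y + t *: (x - y) - P j)
      = (1 - t) * (sg * cross (edge P j) (y - P j)) + t * (sg * cross (edge P j) (x - P j)).
    by rewrite /cross !coordE; ring.
  apply: ltr_wpDr; first exact: mulr_ge0.
  by apply: mulr_gt0; [rewrite subr_gt0|exact: inside_open_half_planes].
by rewrite h addrAC subrr add0r crossZr cross_self !mulr0 ltxx.
Qed.

Lemma no_reflex_convex : convex_polygon P.
Proof.
apply/convex_set_segment; rewrite region_half_planes => x y t /andP[t0 t1] Kx Ky i.
have -> : sg * cross (edge P i) (x + t *: (y - x) - P i)
    = (1 - t) * (sg * cross (edge P i) (x - P i)) + t * (sg * cross (edge P i) (y - P i)).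
  by rewrite /cross !coordE; ring.
by rewrite addr_ge0// mulr_ge0// subr_ge0.
Qed.

End Convexity.

(** * Angles *)

Section Angles.
Context {R : realType}.
Implicit Types (a b u v : R * R) (k l : R).

Lemma enorm_gt0 u : u != 0 -> 0 < enorm u.
Proof. by move=> u0; rewrite sqrtr_gt0 dot_gt0. Qed.

Lemma enorm_sqr u : u != 0 -> enorm u ^+ 2 = dot u u.
Proof. by move=> u0; rewrite sqr_sqrtr// ltW// dot_gt0. Qed.

Lemma enormZ k u : enorm (k *: u) = `|k| * enorm u.
Proof.
have dkk : dot (k *: u) (k *: u) = k ^+ 2 * dot u u by rewrite /dot !coordE; ring.
by rewrite /enorm dkk sqrtrM ?sqr_ge0// sqrtr_sqr.
Qed.

Definition cosine a u := dot a u / (enorm a * enorm u).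
Definition sine a u := cross a u / (enorm a * enorm u).

Lemma cosine_sine a u : a != 0 -> u != 0 -> cosine a u ^+ 2 + sine a u ^+ 2 = 1.
Proof.
move=> a0 u0; have na := enorm_gt0 a0; have nu := enorm_gt0 u0.
rewrite /cosine /sine !expr_div_n -mulrDl exprMn !enorm_sqr//.
rewrite (_ : _ + _ = dot a a * dot u u); last by rewrite /dot /cross; ring.
by rewrite divff// mulf_neq0// gt_eqF// dot_gt0.
Qed.

Lemma cosine_bound a u : a != 0 -> u != 0 -> -1 <= cosine a u <= 1.
Proof.
move=> a0 u0; rewrite -ler_norml -(expr_le1 (n := 2))// real_normK ?num_real//.
by rewrite -(cosine_sine a0 u0) lerDl sqr_ge0.
Qed.

Lemma sine_sg a u : a != 0 -> u != 0 -> Num.sg (sine a u) = Num.sg (cross a u).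
Proof.
move=> a0 u0; rewrite /sine sgrM sgrV (gtr0_sg (mulr_gt0 _ _)) ?enorm_gt0//.
by rewrite mulr1.
Qed.

Lemma sine_gt0 a u : a != 0 -> u != 0 -> (0 < sine a u) = (0 < cross a u).
Proof. by move=> a0 u0; rewrite -sgr_gt0 sine_sg// sgr_gt0. Qed.

Lemma sine_lt0 a u : a != 0 -> u != 0 -> (sine a u < 0) = (cross a u < 0).
Proof. by move=> a0 u0; rewrite -sgr_lt0 sine_sg// sgr_lt0. Qed.

Lemma sine_ge0 a u : a != 0 -> u != 0 -> (0 <= sine a u) = (0 <= cross a u).
Proof. by move=> a0 u0; rewrite !leNgt sine_lt0. Qed.

Lemma ccw_angleE a u :
  ccw_angle a u = if 0 <= cross a u then acos (cosine a u) else 2 * pi - acos (cosine a u).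
Proof. by []. Qed.

Lemma cos_ccw_angle a u : a != 0 -> u != 0 -> cos (ccw_angle a u) = cosine a u.
Proof.
move=> a0 u0; have h := cosine_bound a0 u0; rewrite ccw_angleE.
case: ifP => _; first by rewrite acosK// in_itv.
by rewrite addrC mulr_natl cosD2pi cosN acosK// in_itv.
Qed.

Lemma sin_ccw_angle a u : a != 0 -> u != 0 -> sin (ccw_angle a u) = sine a u.
Proof.
move=> a0 u0; have h := cosine_bound a0 u0; rewrite ccw_angleE.
have E : Num.sqrt (1 - cosine a u ^+ 2) = `|sine a u|.
  by rewrite -(cosine_sine a0 u0) addrC addKr sqrtr_sqr.
case: ifP => c; first by rewrite sin_acos// E ger0_norm// sine_ge0.
rewrite addrC mulr_natl sinD2pi sinN sin_acos// E ltr0_norm ?opprK//.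
by rewrite sine_lt0// ltNge c.
Qed.

Lemma ccw_angle_bound a u : a != 0 -> u != 0 -> 0 <= ccw_angle a u < 2 * pi.
Proof.
move=> a0 u0; have h := cosine_bound a0 u0; rewrite ccw_angleE.
have pi0 := pi_gt0 R; have p0 := acos_ge0 h; have p1 := acos_lepi h.
case: ifPn => [_|]; first by rewrite p0 /=; lra.
rewrite -ltNge -sine_lt0// => s0.
have : 0 < acos (cosine a u).
  apply: acos_gt0; case/andP: h => -> h1; rewrite lt_neqAle h1 andbT /=.
  apply: contraTneq s0 => c1; have := cosine_sine a0 u0.
  rewrite c1 expr1n => /eqP; rewrite -subr_eq0 addrAC subrr add0r sqrf_eq0.
  by move/eqP->; rewrite ltxx.
by move=> p; apply/andP; split; lra.
Qed.

(** The hypothesis excludes equal directions, whose angle is 0 while their cross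
product vanishes. *)
Lemma ccw_angle_lt_pi a u : a != 0 -> u != 0 -> (cross a u = 0 -> dot a u < 0) ->
  (ccw_angle a u < pi) = (0 < cross a u) /\ (pi < ccw_angle a u) = (cross a u < 0).
Proof.
move=> a0 u0 ap; have h := cosine_bound a0 u0; rewrite ccw_angleE.
have pi0 := pi_gt0 R; have p0 := acos_ge0 h; have p1 := acos_lepi h.
have cs := cosine_sine a0 u0.
have lt_pi : cross a u != 0 -> acos (cosine a u) < pi.
  move=> c; apply: acos_ltpi; case/andP: h => h0 ->; rewrite lt_neqAle h0 !andbT.
  apply: contra_neq c => c1; move: cs; rewrite -c1 sqrrN expr1n => /eqP.
  rewrite -subr_eq0 addrAC subrr add0r sqrf_eq0 => /eqP s0.
  by apply/eqP; rewrite -sgr_eq0 -sine_sg// s0 sgr0.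
case: (ltgtP (cross a u) 0) => [c|c|c].
- have := lt_pi (negbT (lt_eqF c)); move=> p /=.
  by split; [apply/negbTE; rewrite -leNgt; lra|lra].
- have := lt_pi (negbT (gt_eqF c)); move=> p /=.
  by split => //; apply/negbTE; rewrite -leNgt ltW.
- have s0 : sine a u = 0 by apply/eqP; rewrite -sgr_eq0 sine_sg// c sgr0.
  have : cosine a u = -1.
    move: cs; rewrite s0 expr0n addr0 => /eqP; rewrite sqrf_eq1 => /orP[|/eqP//].
    have : cosine a u < 0.
      by rewrite pmulr_llt0 ?ap// invr_gt0 mulr_gt0 ?enorm_gt0.
    by move=> c0 /eqP c1; move: c0; rewrite c1 ltNge ler01.
  by move=> ->; rewrite acosN1 /= ltxx.
Qed.

Lemma ccw_angle_gt0 a u : a != 0 -> u != 0 -> (cross a u = 0 -> dot a u < 0) ->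
  0 < ccw_angle a u.
Proof.
move=> a0 u0 ap; case/andP: (ccw_angle_bound a0 u0); rewrite le_eqVlt => /orP[|//].
have [lt_pi _] := ccw_angle_lt_pi a0 u0 ap => /eqP A0.
have s0 : sine a u = 0 by rewrite -sin_ccw_angle// -A0 sin0.
have c0 : cross a u = 0 by apply/eqP; rewrite -sgr_eq0 -sine_sg// s0 sgr0.
by move: lt_pi; rewrite -A0 pi_gt0 c0 ltxx.
Qed.

Lemma sine_diff a u b : a != 0 -> u != 0 -> b != 0 ->
  sine u b = sin (ccw_angle a b - ccw_angle a u).
Proof.
move=> a0 u0 b0; rewrite sinB !cos_ccw_angle// !sin_ccw_angle//.
have na : enorm a != 0 by rewrite gt_eqF ?enorm_gt0.
have nu : enorm u != 0 by rewrite gt_eqF ?enorm_gt0.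
have nb : enorm b != 0 by rewrite gt_eqF ?enorm_gt0.
transitivity ((dot a u * cross a b - cross a u * dot a b)
    / (enorm a ^+ 2 * enorm u * enorm b)); last first.
  by rewrite /sine /cosine; field; rewrite na nu nb.
have -> : dot a u * cross a b - cross a u * dot a b = enorm a ^+ 2 * cross u b.
  by rewrite enorm_sqr// /dot /cross; ring.
by rewrite /sine; field; rewrite na nu nb.
Qed.

(** The angles from [a] to [u] and from [u] to [b] are both less than [pi] if
their sum is at most [pi], and one of them is in any case; an angle less than
[pi] has a positive sine, hence a positive cross product. *)
Lemma ccw_angle_sector a b u : a != 0 -> b != 0 -> u != 0 ->
  0 < ccw_angle a u < ccw_angle a b -> sector 1 a b u.
Proof.
move=> a0 b0 u0 /andP[al ab].
have /andP[_ b2] := ccw_angle_bound a0 b0.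
have pos t : 0 < t < pi -> 0 < sin t by exact: sin_gt0_pi.
have s_u : ccw_angle a u < pi -> 0 < cross a u.
  by move=> h; rewrite -sine_gt0// -sin_ccw_angle// pos// al.
have s_b : ccw_angle a b - ccw_angle a u < pi -> 0 < cross u b.
  move=> h; rewrite -sine_gt0// (sine_diff a0)// pos// h andbT subr_gt0.
  by [].
rewrite /sector !mul1r; case: ifP => c.
  have ba : ccw_angle a b <= pi.
    by rewrite ccw_angleE c acos_lepi// cosine_bound.
  by rewrite s_u ?s_b//; lra.
have [h|h] := ltP (ccw_angle a u) pi; first by rewrite s_u.
by rewrite s_b ?orbT//; lra.
Qed.

(** The witness is the bisector. *)
Lemma ccw_sector_nonempty a b : a != 0 -> b != 0 -> 0 < ccw_angle a b ->
  exists2 u, u != 0 & 0 < ccw_angle a u < ccw_angle a b.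
Proof.
move=> a0 b0; set be := ccw_angle a b => be0.
have /andP[_ be2] := ccw_angle_bound a0 b0; rewrite -/be in be2.
have hpi : 0 < be / 2 < pi by apply/andP; split; lra.
pose u := cos (be / 2) *: a + sin (be / 2) *: rot90 a.
have d0 := dot_gt0 a0.
have s0 : 0 < sin (be / 2) := sin_gt0_pi hpi.
have cu : cross a u = sin (be / 2) * dot a a.
  by rewrite /u /cross /dot !coordE /=; ring.
have du : dot a u = cos (be / 2) * dot a a.
  by rewrite /u /dot !coordE /=; ring.
have cu0 : 0 < cross a u by rewrite cu mulr_gt0.
have u0 : u != 0.
  by apply: contraTneq cu0 => ->; rewrite /cross /= !mulr0 subrr ltxx.
have nu : enorm u = enorm a.
  rewrite /enorm (_ : dot u u = dot a a)//.
  transitivity ((cos (be / 2) ^+ 2 + sin (be / 2) ^+ 2) * dot a a).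
    by rewrite /u /dot !coordE /=; ring.
  by rewrite cos2Dsin2 mul1r.
exists u => //; rewrite ccw_angleE ltW// /cosine du nu -expr2 enorm_sqr//.
rewrite mulfK ?gt_eqF// cosK; first by apply/andP; split; lra.
by rewrite in_itv /=; apply/andP; split; lra.
Qed.

Lemma ccw_angleZ a b k l : 0 < k * l -> ccw_angle (k *: a) (l *: b) = ccw_angle a b.
Proof.
move=> kl; rewrite !ccw_angleE crossZl crossZr mulrA pmulr_rge0//.
suff -> : cosine (k *: a) (l *: b) = cosine a b by [].
rewrite /cosine !enormZ mulrACA -normrM gtr0_norm//.
have -> : dot (k *: a) (l *: b) = (k * l) * dot a b by rewrite /dot !coordE; ring.
by rewrite -mulf_div divff ?mul1r// gt_eqF.
Qed.

End Angles.

Section InternalAngles.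
Context {R : realType} {n : nat} (P : 'I_n -> R * R).
Hypothesis hP : simple_polygon P.
Implicit Types (i : 'I_n) (sg : R).

Lemma sector_angleE i : sector_angle P i = ccw_angle (edge P i) (back P i).
Proof. by []. Qed.

Lemma internal_angle_ccw i : oriented P 1 -> internal_angle P i = sector_angle P i.
Proof.
move=> oP; rewrite /internal_angle; case: asboolP => // -[] u u0 hu.
apply: (fills_near (inside_fills hP (oner_neq0 R) oP i)).
apply: ccw_angle_sector => //; first exact: edge_neq0.
exact: back_neq0.
Qed.

(** The sector that [sector_inside] speaks of is the exterior one. *)
Lemma internal_angle_cw i : oriented P (-1) ->
  internal_angle P i = 2 * pi - sector_angle P i.
Proof.
move=> oP; rewrite /internal_angle; case: asboolP => // sec; exfalso.
have a0 := edge_neq0 hP i; have b0 := back_neq0 hP i.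
have [|u u0 hu] := ccw_sector_nonempty a0 b0.
  by apply: ccw_angle_gt0 => //; exact: vertex_antiparallel.
have N1 : -1 != 0 :> R by rewrite oppr_eq0 oner_neq0.
have out := fills_near (outside_fills hP N1 oP i) (u := u).
rewrite opprK in out.
have {}out := out (ccw_angle_sector a0 b0 u0 hu).
near (0 : R)^'+ => e.
have : (~` inside P) (P i + e *: u) by near: e.
by apply; near: e; exact: sec.
Unshelve. all: by end_near. Qed.

Lemma reflexE sg i : sg = 1 \/ sg = -1 -> oriented P sg ->
  reflex P i = (sg * cross (edge P i) (back P i) < 0).
Proof.
have [lt_pi gt_pi] := ccw_angle_lt_pi (edge_neq0 hP i) (back_neq0 hP i)
  (vertex_antiparallel hP (i := i)).
case=> -> oP; rewrite /reflex.
  by rewrite internal_angle_ccw// sector_angleE mul1r gt_pi.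
rewrite internal_angle_cw// sector_angleE mulN1r oppr_lt0 -lt_pi.
by apply/idP/idP; lra.
Qed.

End InternalAngles.

(** * Parallel polygons *)

Section Parallel.
Context {R : realType} {n : nat}.
Implicit Types (P Q T : 'I_n -> R * R) (u v w : R * R) (i : 'I_n) (k l sg : R).

Definition up_sign w u : int := if up w u then 1 else -1.

(** A form of the crossing number in which the reversal of a side is a change of
signs. *)
Lemma crossing_signs w u v :
  2 * crossing w u v = sgz (cross u v) * (1 - up_sign w u * up_sign w v).
Proof.
by rewrite /crossing /up_sign; case: (up w u) (up w v) => -[] //=; ring.
Qed.

Lemma up_signZ w u k : w != 0 -> u != 0 -> k != 0 ->
  up_sign w (k *: u) = sgz k * up_sign w u.
Proof.
move=> w0 u0 k0; rewrite /up_sign.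
case: (ltgtP k 0) k0 => // k0 _.
  rewrite -[k]opprK scaleNr upN ?scaler_eq0 ?oppr_eq0 ?(lt_eqF k0)//.
  rewrite upZ ?oppr_gt0// opprK ltr0_sgz//.
  by case: up.
by rewrite upZ// gtr0_sgz// mul1r.
Qed.

Section Pair.
Variables (P Q : 'I_n -> R * R) (sg : R).
Hypothesis hP : simple_polygon P.
Hypothesis hQ : simple_polygon Q.
Hypothesis sgE : sg = 1 \/ sg = -1.
Hypothesis oP : oriented P sg.
Hypothesis oQ : oriented Q sg.
Hypothesis par : forall i, parallel (edge P i) (edge Q i).

Let sg0 : sg != 0.
Proof. by case: sgE => ->; rewrite ?oppr_eq0 oner_neq0. Qed.

Let turn (T : 'I_n -> R * R) i := sgz (cross (edge T (ord_pred i)) (edge T i)).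

(** Reversing sides multiplies the sign of a turn and the product of the
up-down signs of its two sides by the same factor, so the part of the count of
crossings that depends on the directions of the sides is common to [P] and [Q]
and the other part is the sum of the signs of the turns. *)
Lemma sum_turns : \sum_i turn P i = \sum_i turn Q i.
Proof.
have [n0|n0] := posnP n.
  by case: hP => h _ _; rewrite n0 in h.
have w0 : edge P (Ordinal n0) != 0 := edge_neq0 hP _.
set w := edge P (Ordinal n0) in w0.
pose mixed (T : 'I_n -> R * R) i :=
  turn T i * (up_sign w (edge T (ord_pred i)) * up_sign w (edge T i)).
have split_sum T : simple_polygon T -> oriented T sg ->
    \sum_i turn T i = 4 * sgz sg + \sum_i mixed T i.
  move=> hT oT; have := total_turning hT sg0 oT w0.
  have -> : 4 * sgz sg = 2 * (2 * sgz sg) by ring.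
  move=> <-; rewrite big_distrr -big_split /=; apply: eq_bigr => i _.
  by rewrite crossing_signs /mixed /turn; ring.
rewrite !split_sum//; congr (_ + _); apply: eq_bigr => i _.
have [k k0 Ek] := par (ord_pred i); have [l l0 El] := par i.
rewrite /mixed /turn Ek El !up_signZ ?(edge_neq0 hP)// crossZl crossZr !sgzM.
have sq (x : R) : x != 0 -> sgz x * sgz x = 1.
  by move=> x0; case: (sgzP x) x0 => //; rewrite eqxx.
have kk := sq k k0; have ll := sq l l0.
set a := sgz k in kk *; set b := sgz l in ll *.
transitivity ((a * a) * (b * b) * (sgz (cross (edge P (ord_pred i)) (edge P i)) *
  (up_sign w (edge P (ord_pred i)) * up_sign w (edge P i)))).
  by rewrite kk ll !mul1r.
by ring.
Qed.

Lemma reflex_turn T i : simple_polygon T -> oriented T sg ->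
  2 * (reflex T i)%:Z = `|turn T i| - sgz sg * turn T i.
Proof.
move=> hT oT; rewrite (reflexE hT _ sgE oT) back_edge crossNr -crossC.
rewrite /turn; case: sgE => ->; rewrite ?mul1r ?mulN1r ?sgzN sgz1.
  by case: sgzP.
by rewrite oppr_lt0; case: sgzP.
Qed.

Lemma reflex_count :
  #|[pred i | reflex P i]| = #|[pred i | reflex Q i]|.
Proof.
have count T : simple_polygon T -> oriented T sg ->
    2 * (#|[pred i | reflex T i]|)%:Z = \sum_i `|turn T i| - sgz sg * \sum_i turn T i.
  move=> hT oT; rewrite -sum1_card big_mkcond /= (big_morph Posz PoszD erefl).
  rewrite !big_distrr -sumrB /=; apply: eq_bigr => i _.
  rewrite -reflex_turn// inE; by case: reflex.
have : 2 * (#|[pred i | reflex P i]|)%:Z = 2 * (#|[pred i | reflex Q i]|)%:Z.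
  rewrite !count// sum_turns; congr (_ - _); apply: eq_bigr => i _.
  have [k k0 Ek] := par (ord_pred i); have [l l0 El] := par i.
  rewrite /turn Ek El crossZl crossZr !sgzM !normrM.
  by rewrite !normr_sgz k0 l0 !mul1r.
by lia.
Qed.

Lemma no_reflexP T : simple_polygon T -> oriented T sg ->
  no_reflex T sg <-> #|[pred i | reflex T i]| = 0%N.
Proof.
move=> hT oT; split=> [nr|/card0_eq c i].
  apply: eq_card0 => i; rewrite inE (reflexE hT _ sgE oT).
  by apply/negbTE; rewrite -leNgt.
have := c i; rewrite !inE (reflexE hT _ sgE oT) => /negbT.
by rewrite -leNgt.
Qed.

Lemma convex_iff_no_reflex T : simple_polygon T -> oriented T sg ->
  convex_polygon T <-> no_reflex T sg.
Proof.
move=> hT oT; split; first exact: convex_no_reflex.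
exact: no_reflex_convex.
Qed.

(** The vectors along the sides at [Q i] are those at [P i] multiplied by two
factors.  These have the same sign, because the two turns do or because both
angles are straight; so the directed angle between the sides is the same. *)
Lemma no_reflex_internal_angle i : no_reflex P sg -> no_reflex Q sg ->
  internal_angle P i = internal_angle Q i.
Proof.
move=> nP nQ; suff E : sector_angle P i = sector_angle Q i.
  case: sgE oP oQ => -> oP' oQ'; first by rewrite !internal_angle_ccw.
  by rewrite !internal_angle_cw// E.
have [k k0 Ek] := par i; have [l l0 El] := par (ord_pred i).
have bQ : back Q i = l *: back P i by rewrite !back_edge El scalerN.
rewrite !sector_angleE Ek bQ ccw_angleZ//.
have lk0 : k * l != 0 by rewrite mulf_neq0.
have scale_cross : sg * cross (k *: edge P i) (l *: back P i)
    = k * l * (sg * cross (edge P i) (back P i)).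
  by rewrite crossZl crossZr; ring.
have := nP i; have := nQ i; rewrite Ek bQ scale_cross.
have [c|c] := eqVneq (cross (edge P i) (back P i)) 0.
  have dP := vertex_antiparallel hP c.
  have := vertex_antiparallel hQ (i := i); rewrite Ek bQ crossZl crossZr c !mulr0.
  have -> : dot (k *: edge P i) (l *: back P i) = k * l * dot (edge P i) (back P i).
    by rewrite /dot !coordE; ring.
  by move=> /(_ erefl); rewrite nmulr_llt0.
move=> sQ sP.
have sP' : 0 < sg * cross (edge P i) (back P i).
  by rewrite lt_neqAle sP andbT eq_sym mulf_neq0.
by move: sQ; rewrite pmulr_lge0// [in X in _ -> X]lt_neqAle eq_sym lk0.
Qed.

Lemma parallel_polygons_convex : convex_polygon P \/ convex_polygon Q ->
  (convex_polygon P /\ convex_polygon Q) /\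
  forall i, internal_angle P i = internal_angle Q i.
Proof.
rewrite !convex_iff_no_reflex// => cPQ.
have [nP nQ] : no_reflex P sg /\ no_reflex Q sg.
  by move: cPQ; rewrite !no_reflexP// reflex_count; case.
by split=> // i; exact: no_reflex_internal_angle.
Qed.

End Pair.
End Parallel.

Lemma counterclockwise_oriented (R : realType) (n : nat) (P : 'I_n -> R * R) :
  counterclockwise P -> oriented P 1.
Proof. by move=> h i t t01; under eq_near do rewrite mul1r; exact: h. Qed.

Lemma clockwise_oriented (R : realType) (n : nat) (P : 'I_n -> R * R) :
  clockwise P -> oriented P (-1).
Proof.
by move=> h i t t01; under eq_near do rewrite mulN1r scaleNr; exact: h.
Qed.

Theorem proposition1 (R : realType) (n : nat) (P Q : 'I_n -> R * R)
    (hP : simple_polygon P) (hQ : simple_polygon Q)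
    (hPQ : parallel_polygons P Q) :
  #|[pred i | reflex P i]| = #|[pred i | reflex Q i]| /\
  (convex_polygon P \/ convex_polygon Q ->
     (convex_polygon P /\ convex_polygon Q) /\
     forall i : 'I_n, internal_angle P i = internal_angle Q i).
Proof.
case: hPQ => orient par.
have [sg [sgE oP oQ]] : exists sg : R,
    [/\ sg = 1 \/ sg = -1, oriented P sg & oriented Q sg].
  case: orient => -[oP oQ]; [exists 1|exists (-1)].
    by split; [left|exact: counterclockwise_oriented..].
  by split; [right|exact: clockwise_oriented..].
split; first exact: (reflex_count hP hQ sgE).
exact: (parallel_polygons_convex hP hQ sgE).
Qed.
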